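(* Let $1<p<q\le\infty$ with $\frac1p+\frac1q<1$, and define $F_{p,q}:\mathcal{S}(\mathbb{R})\setminus\{0\}\to\mathbb{R}_{>0}$ by \[F_{p,q}(f)=\frac{\|f\|_q\|\hat f\|_q}{\|f\|_p\|\hat f\|_p}.\] Then the image of $F_{p,q}$ is all of $\mathbb{R}_{>0}$.
   Context: $\mathcal{S}(\mathbb{R})$ is the space of Schwartz functions on $\mathbb{R}$; $\|\cdot\|_r$ is the $L^r(\mathbb{R})$ norm with respect to Lebesgue measure; the Fourier transform is $\hat f(\xi)=\int_{\mathbb{R}}f(x)e^{-2\pi i x\xi}\,dx$. *)

(* Defs.v *)
From HB Require Import structures.
From mathcomp Require Import all_boot all_order all_algebra.
From mathcomp Require Import all_classical all_reals all_analysis.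
Set Implicit Arguments. Unset Strict Implicit. Unset Printing Implicit Defensive.
Import Order.TTheory GRing.Theory Num.Theory numFieldNormedType.Exports.
Local Open Scope classical_set_scope.
Local Open Scope ring_scope.

(* A complex-valued function on R, as (real part, imaginary part). *)
Definition cfun (R : realType) := ((R -> R) * (R -> R))%type.

Definition schwartzR (R : realType) (g : R -> R) : Prop :=
  (forall n x, derivable (derive1n n g) x 1) /\
  (forall a b : nat, exists C : R, forall x : R, `|x| ^+ a * `|derive1n b g x| <= C).

Definition schwartz (R : realType) (f : cfun R) : Prop :=
  schwartzR f.1 /\ schwartzR f.2.

Definition cmod (R : realType) (f : cfun R) (x : R) : R :=
  Num.sqrt (f.1 x ^+ 2 + f.2 x ^+ 2).

(* Fourier transform  \hat f(xi) = \int f(x) e^{-2 pi i x xi} dx,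
   e^{-i t} = cos t - i sin t. *)
Definition fourier (R : realType) (f : cfun R) : cfun R :=
  (fun xi => Rintegral lebesgue_measure setT
     (fun x => f.1 x * cos (2 * pi * x * xi) + f.2 x * sin (2 * pi * x * xi)),
   fun xi => Rintegral lebesgue_measure setT
     (fun x => f.2 x * cos (2 * pi * x * xi) - f.1 x * sin (2 * pi * x * xi))).

Definition Lr (R : realType) (r : \bar R) (f : cfun R) : R :=
  fine (Lnorm lebesgue_measure r (fun x => (cmod f x)%:E)).

Definition Fpq (R : realType) (p q : \bar R) (f : cfun R) : R :=
  (Lr q f * Lr q (fourier f)) / (Lr p f * Lr p (fourier f)).

Definition cfun_zero (R : realType) : cfun R := (fun _ => 0, fun _ => 0).

(* Main.v *)
Require Import Defs.
From HB Require Import structures.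
From mathcomp Require Import all_boot all_order all_algebra.
From mathcomp Require Import all_classical all_reals all_analysis.
From mathcomp Require Import measurable_realfun ess_sup_inf.
From mathcomp Require Import ring lra.
Import Order.TTheory GRing.Theory Num.Theory numFieldNormedType.Exports.
Local Open Scope classical_set_scope.
Local Open Scope ring_scope.

Set Implicit Arguments.
Unset Strict Implicit.

(* F_{p,q} is continuous along segments of nonzero Schwartz functions, by Minkowski's inequality and
   the linearity of the Fourier transform, so by the intermediate value theorem it suffices to find
   Schwartz functions on which it is arbitrarily small and arbitrarily large.
   Small: for the chirp f = e^{-pi (1 + i b) x^2} both |f| and |\hat f| are Gaussians, of widths 1 and
   sqrt(1 + b^2), so F(f) is a constant times (1 + b^2)^{-(1/p - 1/q)/2}.
   Large: f = e^s g(e^{2s} x) + e^{-s} g(e^{-2s} x), with g = e^{-pi x^2}, is its own Fourier transform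
   and F(f) = (||f||_q / ||f||_p)^2 is at least a constant times e^{2 d s}, where d is the smaller of
   2 (1/p - 1/q) and 2 (1 - 1/p - 1/q).
   That F is positive requires \hat f <> 0 for f <> 0; it follows by integrating \hat f against
   Gaussians, which shows that \hat f = 0 makes all Gaussian averages of f vanish. *)

(** * Norms of continuous functions with quadratic decay *)

(** All estimates take place in the class [decays]: continuous functions that are O(1/(1 + x^2)).
    Every L^r norm with 1 <= r <= oo is finite there, and two integrations by parts place the
    transform of a Schwartz function in it; nothing stronger about \hat f is used. The quotient F
    makes no sense at 0, so the segment between the two extremal functions must avoid 0. This holds
    because the chirp has a non-zero imaginary part at some point, while the function with large F
    is real and positive at 0. The exponent d comes from scaling. The two terms of the large example
    have L^r norms proportional to e^{s (1 - 2/r)} and e^{-s (1 - 2/r)}. The first term alone bounds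
    ||f||_q from below, both together bound ||f||_p from above, and the differences of exponents are
    2 s (1/p - 1/q) and 2 s (1 - 1/p - 1/q). Only here does the hypothesis 1/p + 1/q < 1 enter. *)

Section decay.
Context {R : realType}.
Implicit Types (h k : R -> R) (r : \bar R).
Local Notation mu := (@lebesgue_measure R).

(** Contains the Schwartz functions, their cosine and sine transforms, and the moduli of pairs of
    such functions, so one class serves both [f] and its transform. *)
Definition decays h :=
  continuous h /\ exists C, forall x, `|h x| <= C * (oneDsqr x)^-1.

Lemma integrable_oneDsqrV :
  mu.-integrable setT (EFin \o (fun x : R => (oneDsqr x)^-1)).
Proof.
apply/integrableP; split.
  apply/measurable_EFinP; apply: continuous_measurable_fun.
  exact: continuous_oneDsqrV.
under eq_integral do rewrite /= ger0_norm ?invr_ge0//.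
rewrite ge0_symfun_integralT.
- have -> : [set x | 0 <= x] = `[0, +oo[%classic :> set R.
    by apply/seteqP; split => x /=; rewrite in_itv/= andbT.
  by rewrite integral0y_oneDsqr -EFinM ltry.
- by move=> x; rewrite invr_ge0.
- exact: continuous_oneDsqrV.
- by move=> x/=; rewrite /oneDsqr sqrrN.
Qed.

Lemma measurable_decays h : decays h -> measurable_fun setT h.
Proof. by move=> [ch _]; exact: continuous_measurable_fun. Qed.

Lemma integrable_decays h : decays h -> mu.-integrable setT (EFin \o h).
Proof.
move=> dh; have [_ [C hC]] := dh.
have := @le_integrable _ _ R mu setT measurableT (EFin \o h) (EFin \o (fun x : R => C * (oneDsqr x)^-1)).
apply => //.
- by apply/measurable_EFinP; exact: measurable_decays.
- move=> x _ /=; rewrite lee_fin (le_trans (hC x))// ler_norm//.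
- have -> : EFin \o (fun x : R => C * (oneDsqr x)^-1) =
            (fun x => C%:E * (EFin \o (fun x => (oneDsqr x)^-1)%R) x)%E.
    by apply/funext => x; rewrite /= EFinM.
  by apply: integrableZl => //; exact: integrable_oneDsqrV.
Qed.

Lemma decaysM h k : decays h -> continuous k -> (forall x, `|k x| <= 1) ->
  decays (fun x => h x * k x).
Proof.
move=> [ch [C hC]] ck k1; split; first by move=> x; apply: cvgM; [exact: ch|exact: ck].
exists C => x; rewrite normrM (le_trans _ (hC x))//.
by rewrite ler_piMr.
Qed.

Lemma decaysD h k : decays h -> decays k -> decays (fun x => h x + k x).
Proof.
move=> [ch [C hC]] [ck [D kD]]; split; first by move=> x; apply: cvgD; [exact: ch|exact: ck].
by exists (C + D) => x; rewrite mulrDl (le_trans (ler_normD _ _))// lerD.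
Qed.

Lemma decaysZ h (c : R) : decays h -> decays (fun x => c * h x).
Proof.
move=> [ch [C hC]]; split; first by move=> x; apply: cvgM; [exact: cvg_cst|exact: ch].
by exists (`|c| * C) => x; rewrite normrM -mulrA ler_wpM2l.
Qed.

Lemma decaysN h : decays h -> decays (fun x => - h x).
Proof.
by move=> /(decaysZ (-1)); congr decays; apply/funext => x; rewrite mulN1r.
Qed.

Lemma decays0 : decays (fun=> 0).
Proof.
split; first by move=> x; exact: cvg_cst.
by exists 0 => x; rewrite normr0 mul0r.
Qed.

(** At exponent [+oo], [Lnorm] unfolds to a test on the measure of the whole space; this selects the
    branch with the essential supremum. *)
Lemma mu_setT_gt0 : (0 < mu setT)%E.
Proof.
have : (mu `[0%R, 1%R] <= mu setT)%E by apply: le_measure; rewrite ?inE.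
by apply: lt_le_trans; rewrite lebesgue_measure_itv/= lte_fin ltr01 sube0 lte_fin.
Qed.

Definition NL r h : R := fine (Lnorm mu r (EFin \o h)).

Lemma NL_ge0 r h : 0 <= NL r h.
Proof. exact/fine_ge0/Lnorm_ge0. Qed.

Lemma le_LnormR r h k : (1 <= r)%E -> measurable_fun setT h -> measurable_fun setT k ->
  (forall x, `|h x| <= `|k x|) ->
  (Lnorm mu r (EFin \o h) <= Lnorm mu r (EFin \o k))%E.
Proof.
move=> r1 mh mk hk; case: r r1 => [r| |]; last (by []); move=> r1; rewrite unlock.
- have r0 : 0 <= r by rewrite (le_trans ler01)// -lee_fin.
  have mP (g : R -> R) : measurable_fun setT g ->
      measurable_fun setT (fun x => `|(EFin \o g) x| `^ r)%E.
    move=> mg; under eq_fun do rewrite poweR_EFin.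
    apply/measurable_EFinP; apply: (measurableT_comp (measurable_powR r)).
    exact: measurableT_comp.
  have i0 (g : R -> R) : (0 <= \int[mu]_x (`|(EFin \o g) x| `^ r))%E.
    by apply: integral_ge0 => x _; exact: poweR_ge0.
  apply: gt0_ler_poweR; [by rewrite invr_ge0|by rewrite in_itv/= leey andbT i0..|].
  apply: ge0_le_integral => //.
  + by move=> x _; exact: poweR_ge0.
  + exact: mP.
  + exact: mP.
  + by move=> x _; rewrite /= lee_fin ge0_ler_powR// nnegrE.
- case: ifP => // _; apply: le_ess_sup; apply: nearW => x /=.
  by rewrite lee_fin.
Qed.

(** Since 1/(1 + x^2) <= 1, raising it to a power r >= 1 only decreases it, so |h|^r <= C^r / (1 +
    x^2), which is integrable. *)
Lemma Lnorm_decays_lty r h : (1 <= r)%E -> decays h ->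
  (Lnorm mu r (EFin \o h) < +oo)%E.
Proof.
move=> r1 dh; have [ch [C hC]] := dh.
have mh := measurable_decays dh.
have C0 : 0 <= C.
  have := le_trans (normr_ge0 _) (hC 0).
  by rewrite pmulr_lge0// invr_gt0 (lt_le_trans ltr01).
case: r r1 => [r| |]; last (by []); move=> r1; rewrite unlock.
- apply: poweR_lty.
  have mo : measurable_fun setT (fun x => C `^ r * (oneDsqr x)^-1).
    by apply: continuous_measurable_fun => x; apply: cvgM;
      [exact: cvg_cst|exact: continuous_oneDsqrV].
  apply: (@le_lt_trans _ _ (\int[mu]_x (C `^ r * (oneDsqr x)^-1)%:E)%E).
  { apply: ge0_le_integral => //.
    * by move=> x _; exact: poweR_ge0.
    * under eq_fun do rewrite poweR_EFin.
      apply/measurable_EFinP; apply: (measurableT_comp (measurable_powR r)).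
      exact: measurableT_comp.
    * by apply/measurable_EFinP.
    * move=> x _; rewrite /= lee_fin.
      have oV0 : 0 < (oneDsqr x)^-1 by rewrite invr_gt0 (lt_le_trans ltr01).
      have r0 : 0 <= r by rewrite (le_trans ler01)// -lee_fin.
      apply: (@le_trans _ _ ((C * (oneDsqr x)^-1) `^ r)).
        by rewrite ge0_ler_powR// nnegrE// mulr_ge0// ltW.
      rewrite powRM ?(ltW oV0)// ler_wpM2l ?powR_ge0//.
      rewrite -[leRHS]powRr1 ?(ltW oV0)//; apply: ger_powR => //.
      by rewrite oV0/= invf_le1// (lt_le_trans ltr01). }
  under eq_integral do rewrite EFinM.
  rewrite ge0_integralZl_EFin ?powR_ge0//.
  + rewrite lte_mul_pinfty// ?lee_fin ?powR_ge0//.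
    have /integrableP[_] := integrable_oneDsqrV.
    by congr (_ < _)%E; apply: eq_integral => x _; rewrite /= ger0_norm.
  + apply/measurable_EFinP; apply: continuous_measurable_fun.
    exact: continuous_oneDsqrV.
- rewrite mu_setT_gt0; apply: (@le_lt_trans _ _ C%:E); last exact: ltry.
  apply/ess_supP; apply: nearW => x /=; rewrite lee_fin (le_trans (hC x))//.
  by rewrite ler_piMr// invf_le1// (lt_le_trans ltr01).
Qed.

(** [fine] sends infinity to 0, so facts about extended norms pass to [NL] only through this
    finiteness. *)
Lemma NLK r h : (1 <= r)%E -> decays h -> (NL r h)%:E = Lnorm mu r (EFin \o h).
Proof.
by move=> r1 dh; rewrite fineK// ge0_fin_numE ?Lnorm_ge0// Lnorm_decays_lty.
Qed.

Lemma le_NL r h k : (1 <= r)%E -> decays h -> decays k ->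
  (forall x, `|h x| <= `|k x|) -> NL r h <= NL r k.
Proof.
move=> r1 dh dk hk; rewrite -lee_fin !NLK//.
by apply: le_LnormR => //; exact: measurable_decays.
Qed.

Lemma NLD r h k : (1 <= r)%E -> decays h -> decays k ->
  NL r (fun x => h x + k x) <= NL r h + NL r k.
Proof.
move=> r1 dh dk; rewrite -lee_fin EFinD !NLK//; last exact: decaysD.
by apply: (@eminkowski _ _ _ mu h k) => //; exact: measurable_decays.
Qed.

Lemma NLZ r h (c : R) : (1 <= r)%E -> decays h -> 0 <= c ->
  NL r (fun x => c * h x) = c * NL r h.
Proof.
move=> r1 dh c0; apply: EFin_inj; rewrite EFinM !NLK//; last exact: decaysZ.
case: r r1 => [r| |]; last (by []); move=> r1; rewrite unlock.
- have r0 : r != 0 by rewrite gt_eqF// (lt_le_trans ltr01).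
  have -> : (\int[mu]_x (`|(EFin \o (fun x => c * h x)%R) x| `^ r) =
      (c `^ r)%:E * \int[mu]_x (`|(EFin \o h) x| `^ r))%E.
  { rewrite -ge0_integralZl_EFin ?powR_ge0//.
    * apply: eq_integral => x _ /=; rewrite -EFinM.
      by rewrite normrM powRM// ger0_norm.
    * by move=> x _; exact: poweR_ge0.
    * under eq_fun do rewrite poweR_EFin.
      apply/measurable_EFinP; apply: (measurableT_comp (measurable_powR r)).
      by apply: measurableT_comp => //; exact: measurable_decays. }
  rewrite poweRM//; last by apply: integral_ge0 => x _; exact: poweR_ge0.
    by rewrite poweR_EFin -powRrM mulfV// powRr1.
  by rewrite lee_fin powR_ge0.
- rewrite mu_setT_gt0 -ess_supZl//; last exact: mu_setT_gt0.
  by congr ess_sup; apply/funext => x /=; rewrite normrM EFinM ger0_norm.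
Qed.

(** By continuity a violation at one point spreads to a ball, which has positive measure and cannot
    lie in a null set. *)
Lemma ae_le_continuous h (y : R) : continuous h ->
  (\forall x \ae mu, h x <= y) -> forall x, h x <= y.
Proof.
move=> ch [Z [mZ Z0 hZ]] x0; rewrite leNgt; apply/negP => yhx0.
have e0 : 0 < h x0 - y by rewrite subr_gt0.
have : \forall x \near x0, y < h x.
  have /cvgrPdist_lt/(_ _ e0) := ch x0.
  by apply: filterS => x; rewrite ltr_norml => /andP[_]; rewrite ltrD2l ltrN2.
move=> {e0} /nbhs_ballP[e /= e0 eh].
have : (mu (ball x0 e) <= mu Z)%E.
  apply: le_measure; rewrite ?inE//; first exact: measurable_ball.
  by apply: subset_trans hZ => x /eh /= yhx; apply/negP; rewrite -ltNge.
rewrite Z0 (lebesgue_measure_ball _ (ltW e0)) lee_fin leNgt => /negP; apply.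
by rewrite pmulrn_rgt0.
Qed.

Lemma continuous_normr_comp h : continuous h -> continuous (fun x => `|h x|).
Proof. by move=> ch x; apply: cvg_norm; exact: ch. Qed.

Lemma NL_gt0 r h x0 : (1 <= r)%E -> decays h -> h x0 != 0 -> 0 < NL r h.
Proof.
move=> r1 dh; apply: contraNT; rewrite -leNgt => N0; rewrite -normr_le0.
have {}N0 : Lnorm mu r (EFin \o h) = 0%E.
  by rewrite -NLK//; congr EFin; apply/eqP; rewrite eq_le N0 NL_ge0.
have r0 : (0 < r)%E by apply: lt_le_trans r1.
have mh : measurable_fun setT (EFin \o h).
  by apply/measurable_EFinP; exact: measurable_decays.
apply: (@ae_le_continuous (fun x => `|h x|)); first exact: continuous_normr_comp dh.1.
have := Lnorm_eq0_eq0 _ r0 N0; move=> /(_ mh).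
by apply: filterS => x h0; case: (h0 I) => ->; rewrite normr0.
Qed.

Lemma normr_le_NLy h x0 : decays h -> `|h x0| <= NL +oo h.
Proof.
move=> dh; apply: (@ae_le_continuous (fun x => `|h x|)); first exact: continuous_normr_comp dh.1.
have := ess_sup_ge mu (abse \o (EFin \o h)).
apply: filterS => x /=; rewrite -lee_fin NLK ?leey// => hx; apply: le_trans hx _.
by rewrite unlock mu_setT_gt0.
Qed.

End decay.

(** * Derivatives of products and compositions *)

Section derivatives.
Context {R : realType}.
Implicit Types (f g u : R -> R) (x a b c : R).

Lemma is_deriveM_fun f g x a b : is_derive x 1 f a -> is_derive x 1 g b ->
  is_derive x 1 (fun y => f y * g y) (a * g x + f x * b).
Proof.
move=> fa gb; apply: (@is_derive_eq _ _ _ _ _ _ _ (f x *: b + g x *: a)).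
by rewrite /GRing.scale/= addrC (mulrC a).
Qed.

Lemma is_deriveD_fun f g x a b : is_derive x 1 f a -> is_derive x 1 g b ->
  is_derive x 1 (fun y => f y + g y) (a + b).
Proof. by move=> fa gb; exact: is_deriveD. Qed.

Lemma is_deriveZ_fun c f x a : is_derive x 1 f a ->
  is_derive x 1 (fun y => c * f y) (c * a).
Proof. by move=> fa; exact: (@is_deriveZ _ _ _ f c). Qed.

Lemma is_derive_cos_comp u x a : is_derive x 1 u a ->
  is_derive x 1 (fun y => cos (u y)) (- sin (u x) * a).
Proof. by move=> ua; apply: (@is_derive1_comp _ cos u). Qed.

Lemma is_derive_sin_comp u x a : is_derive x 1 u a ->
  is_derive x 1 (fun y => sin (u y)) (cos (u x) * a).
Proof. by move=> ua; apply: (@is_derive1_comp _ sin u). Qed.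

Lemma is_derive_expR_comp u x a : is_derive x 1 u a ->
  is_derive x 1 (fun y => expR (u y)) (expR (u x) * a).
Proof. by move=> ua; apply: (@is_derive1_comp _ expR u). Qed.

Lemma is_derive_linear c x : is_derive x 1 (fun y => c * y) c.
Proof.
by rewrite -[X in is_derive _ _ _ X]mulr1; exact: is_deriveZ_fun.
Qed.

Lemma is_derive_quadratic c x : is_derive x 1 (fun y => c * y ^+ 2) (c * (2 * x)).
Proof.
apply: is_deriveZ_fun; have -> : (fun y => y ^+ 2) = (fun y => y * y) :> (R -> R).
  by apply/funext => y; rewrite expr2.
have -> : 2 * x = 1 * x + x * 1 by rewrite mulr1 mul1r mulr_natl mulr2n.
exact: is_deriveM_fun.
Qed.

Lemma is_derive_continuous f (f' : R -> R) :
  (forall x, is_derive x 1 f (f' x)) -> continuous f.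
Proof.
move=> df x; apply: differentiable_continuous.
by apply/derivable1_diffP; case: (df x).
Qed.

End derivatives.

(** * The integral of a derivative over the line *)

Section integral_derivative.
Context {R : realType}.
Local Notation mu := (@lebesgue_measure R).

Lemma cvg_oneDsqrV_nat : (oneDsqr n%:R : R)^-1 @[n --> \oo] --> (0 : R).
Proof.
apply: (@squeeze_cvgr _ _ _ _ (cst 0) (@harmonic R)).
- apply: nearW => n; rewrite /harmonic /= invr_ge0 (le_trans ler01 (oneDsqr_ge1 _))/=.
  rewrite lef_pV2; last 2 first.
  + by rewrite posrE; exact: lt_le_trans ltr01 (oneDsqr_ge1 _).
  + by rewrite posrE ltr0n.
  by rewrite /oneDsqr -natrX nat1r ler_nat ltnS; case: (n) => // m; rewrite leq_pmulr.
- exact: cvg_cst.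
- exact: cvg_harmonic.
Qed.

(** The integral over [-n, n] is g(n) - g(-n), which tends to 0 by the decay of [g]; by dominated
    convergence it also tends to the full integral. Applied to a product, this is integration by
    parts without boundary terms. *)
Lemma Rintegral_derive_eq0 (g g' : R -> R) :
  (forall x : R, is_derive x 1 g (g' x)) -> decays g -> decays g' ->
  \int[mu]_x g' x = 0.
Proof.
move=> dg dec_g dec_g'; have cg := dec_g.1; have cg' := dec_g'.1.
have [_ [C hC]] := dec_g.
pose G n x := ((EFin \o g') \_ `[(- n%:R)%R, n%:R%R]%classic) x.
(* The fundamental theorem is applied on a non-degenerate interval, hence [0 < n]. *)
have GE (n : nat) : (0 < n)%N -> (\int[mu]_x G n x = (g n%:R - g (- n%:R))%:E)%E.
  move=> n0; rewrite -integral_mkcond.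
  rewrite (@continuous_FTC2 _ g' g)//.
  - by rewrite (@lt_trans _ _ 0)// ?oppr_lt0 ltr0n.
  - exact: continuous_subspaceT.
  - split; first by move=> x _; case: (dg x).
    + exact/cvg_at_right_filter/cg.
    + exact/cvg_at_left_filter/cg.
  - by move=> x _; rewrite derive1E; case: (dg x).
have lim1 : (\int[mu]_x G n x)%E @[n --> \oo] --> (\int[mu]_x (g' x)%:E)%E.
  apply: (@dominated_cvg _ _ _ mu setT measurableT G (EFin \o g')
    (fun x => (`|g' x|)%:E)) => //.
  - move=> n; apply/(measurable_restrictT _ _).1 => //.
    by apply: measurable_funTS; apply/measurable_EFinP; exact: measurable_decays.
  - move=> x _; apply: cvg_near_cst; near=> n; rewrite /G patchE ifT//.
    rewrite inE/= in_itv/= -ler_norml ltW//; near: n; exact: nbhs_infty_gtr.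
  - exact: integrable_norm (integrable_decays dec_g').
  - move=> n x _; rewrite /G patchE; case: ifPn => _ /=; first by rewrite lee_fin.
    by rewrite normr0 lee_fin.
have lim2 : (\int[mu]_x G n x)%E @[n --> \oo] --> (0 : \bar R)%E.
  apply/fine_cvgP; split.
    by near=> n; rewrite GE//; near: n; exact: nbhs_infty_gt.
  have bnd : `|fine (\int[mu]_x G n x)%E| @[n --> \oo] --> (0 : R).
    apply: (@squeeze_cvgr _ _ _ _ (cst 0) (fun n => (C + C) * (oneDsqr n%:R : R)^-1)).
    + near=> n; rewrite /= normr_ge0/= GE/=; last by near: n; exact: nbhs_infty_gt.
      rewrite (le_trans (ler_normB _ _))// mulrDl lerD// (le_trans (hC _))//.
      by rewrite /oneDsqr sqrrN.
    + exact: cvg_cst.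
    + by rewrite -[X in _ --> X](mulr0 (C + C)); apply: cvgMr; exact: cvg_oneDsqrV_nat.
  exact: norm_cvg0 bnd.
by rewrite /Rintegral (cvg_unique _ lim1 lim2).
Unshelve. all: by end_near. Qed.

End integral_derivative.

(** * Cosine and sine transforms *)

Section trig_transforms.
Context {R : realType}.
Local Notation mu := (@lebesgue_measure R).
Implicit Types (g : R -> R) (x xi : R).

(** With [sinT], the real building blocks of the Fourier transform: \hat f = (cosT f1 + sinT f2) + i
    (cosT f2 - sinT f1). *)
Definition cosT g xi : R := \int[mu]_x (g x * cos (2 * pi * x * xi)).
Definition sinT g xi : R := \int[mu]_x (g x * sin (2 * pi * x * xi)).

Lemma is_derive_phase xi x :
  is_derive x 1 (fun y : R => 2 * pi * y * xi) (2 * pi * xi).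
Proof.
have -> : (fun y : R => 2 * pi * y * xi) = (fun y => (2 * pi * xi) * y).
  by apply/funext => y; rewrite mulrAC.
exact: is_derive_linear.
Qed.

Lemma norm_cos_le1 x : `|cos x| <= 1.
Proof. by rewrite ler_norml cos_geN1 cos_le1. Qed.

Lemma norm_sin_le1 x : `|sin x| <= 1.
Proof. by rewrite ler_norml sin_geN1 sin_le1. Qed.

Lemma decays_cos g xi : decays g -> decays (fun x => g x * cos (2 * pi * x * xi)).
Proof.
move=> dg; apply: decaysM => //; last by move=> x; exact: norm_cos_le1.
apply: (is_derive_continuous (f' := fun x => - sin (2 * pi * x * xi) * (2 * pi * xi))).
by move=> x; apply: is_derive_cos_comp; exact: is_derive_phase.
Qed.

Lemma decays_sin g xi : decays g -> decays (fun x => g x * sin (2 * pi * x * xi)).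
Proof.
move=> dg; apply: decaysM => //; last by move=> x; exact: norm_sin_le1.
apply: (is_derive_continuous (f' := fun x => cos (2 * pi * x * xi) * (2 * pi * xi))).
by move=> x; apply: is_derive_sin_comp; exact: is_derive_phase.
Qed.

Lemma RintegralD_decays (g h : R -> R) : decays g -> decays h ->
  \int[mu]_x (g x + h x) = \int[mu]_x g x + \int[mu]_x h x.
Proof. by move=> dg dh; rewrite RintegralD//; exact: integrable_decays. Qed.

Lemma RintegralZ_decays (c : R) (g : R -> R) : decays g ->
  \int[mu]_x (c * g x) = c * \int[mu]_x g x.
Proof. by move=> dg; rewrite RintegralZl//; exact: integrable_decays. Qed.

Lemma cosTD (g h : R -> R) xi : decays g -> decays h ->
  cosT (fun x => g x + h x) xi = cosT g xi + cosT h xi.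
Proof.
move=> dg dh; rewrite -RintegralD_decays; [|exact: decays_cos..].
by apply: eq_Rintegral => x _; rewrite mulrDl.
Qed.

Lemma sinTD (g h : R -> R) xi : decays g -> decays h ->
  sinT (fun x => g x + h x) xi = sinT g xi + sinT h xi.
Proof.
move=> dg dh; rewrite -RintegralD_decays; [|exact: decays_sin..].
by apply: eq_Rintegral => x _; rewrite mulrDl.
Qed.

Lemma cosTZ (c : R) (g : R -> R) xi : decays g ->
  cosT (fun x => c * g x) xi = c * cosT g xi.
Proof.
move=> dg; rewrite -RintegralZ_decays; last exact: decays_cos.
by apply: eq_Rintegral => x _; rewrite mulrA.
Qed.

Lemma sinTZ (c : R) (g : R -> R) xi : decays g ->
  sinT (fun x => c * g x) xi = c * sinT g xi.
Proof.
move=> dg; rewrite -RintegralZ_decays; last exact: decays_sin.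
by apply: eq_Rintegral => x _; rewrite mulrA.
Qed.

Lemma cosT0 xi : cosT (fun=> 0) xi = 0.
Proof.
rewrite /cosT; under eq_Rintegral do rewrite mul0r.
by rewrite Rintegral_cst// mul0r.
Qed.

Lemma sinT0 xi : sinT (fun=> 0) xi = 0.
Proof.
rewrite /sinT; under eq_Rintegral do rewrite mul0r.
by rewrite Rintegral_cst// mul0r.
Qed.

(** Integration by parts: the derivative [D] of g(x) cos(2 pi x xi) has integral 0. *)
Lemma cosT_derive (g g' : R -> R) xi : (forall x : R, is_derive x 1 g (g' x)) ->
  decays g -> decays g' -> cosT g' xi = (2 * pi * xi) * sinT g xi.
Proof.
move=> dgg' dg dg'; apply/eqP; rewrite -subr_eq0; apply/eqP.
pose D x := g' x * cos (2 * pi * x * xi)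
            + g x * (- sin (2 * pi * x * xi) * (2 * pi * xi)).
have DE : D = (fun x => g' x * cos (2 * pi * x * xi)
            + (- (2 * pi * xi)) * (g x * sin (2 * pi * x * xi))).
  by apply/funext => x; rewrite /D; congr (_ + _); ring.
have dD : decays D.
  by rewrite DE; apply: decaysD; [exact: decays_cos|exact/decaysZ/decays_sin].
have isD (x : R) : is_derive x 1 (fun x => g x * cos (2 * pi * x * xi)) (D x).
  apply: is_deriveM_fun => //.
  by apply: is_derive_cos_comp; exact: is_derive_phase.
rewrite -(Rintegral_derive_eq0 isD (decays_cos xi dg) dD).
rewrite DE RintegralD_decays ?RintegralZ_decays//; rewrite ?mulNr//.
- exact: decays_sin.
- exact: decays_cos.
- exact/decaysZ/decays_sin.
Qed.

Lemma sinT_derive (g g' : R -> R) xi : (forall x : R, is_derive x 1 g (g' x)) ->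
  decays g -> decays g' -> sinT g' xi = - ((2 * pi * xi) * cosT g xi).
Proof.
move=> dgg' dg dg'; apply/eqP; rewrite -subr_eq0 opprK; apply/eqP.
pose D x := g' x * sin (2 * pi * x * xi)
            + g x * (cos (2 * pi * x * xi) * (2 * pi * xi)).
have DE : D = (fun x => g' x * sin (2 * pi * x * xi)
            + (2 * pi * xi) * (g x * cos (2 * pi * x * xi))).
  by apply/funext => x; rewrite /D; congr (_ + _); ring.
have dD : decays D.
  by rewrite DE; apply: decaysD; [exact: decays_sin|exact/decaysZ/decays_cos].
have isD (x : R) : is_derive x 1 (fun x => g x * sin (2 * pi * x * xi)) (D x).
  apply: is_deriveM_fun => //.
  by apply: is_derive_sin_comp; exact: is_derive_phase.
rewrite -(Rintegral_derive_eq0 isD (decays_sin xi dg) dD).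
rewrite DE RintegralD_decays ?RintegralZ_decays//.
- exact: decays_cos.
- exact: decays_sin.
- exact/decaysZ/decays_cos.
Qed.

Lemma le_norm_Rintegral_decays (g h : R -> R) : decays g -> decays h ->
  (forall x, `|h x| <= `|g x|) -> `|\int[mu]_x h x| <= \int[mu]_x `|g x|.
Proof.
move=> dg dh hg; apply: (@le_trans _ _ (\int[mu]_x `|h x|)).
  by apply: le_normr_Rintegral => //; exact: integrable_decays.
by apply: le_Rintegral => //; exact: integrable_norm (integrable_decays _).
Qed.

Lemma norm_cosT_le g xi : decays g -> `|cosT g xi| <= \int[mu]_x `|g x|.
Proof.
move=> dg; apply: le_norm_Rintegral_decays => //; first exact: decays_cos.
by move=> x; rewrite normrM ler_piMr// norm_cos_le1.
Qed.

Lemma norm_sinT_le g xi : decays g -> `|sinT g xi| <= \int[mu]_x `|g x|.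
Proof.
move=> dg; apply: le_norm_Rintegral_decays => //; first exact: decays_sin.
by move=> x; rewrite normrM ler_piMr// norm_sin_le1.
Qed.

Lemma continuous_param_integral (F : R -> R -> R) g : decays g ->
  (forall xi, decays (F xi)) -> (forall x, continuous (F ^~ x)) ->
  (forall xi x, `|F xi x| <= `|g x|) ->
  continuous (fun xi => \int[mu]_x F xi x).
Proof.
move=> dg dF cF Fg xi0.
apply: (@continuity_under_integral _ _ _ mu F setT measurableT (xi0 - 1) (xi0 + 1)
  _ _ (fun x => `|g x|)).
- by move=> xi _; exact: integrable_decays.
- by apply: aeW => x _ xi _; exact: cF.
- exact: integrable_norm (integrable_decays dg).
- by move=> xi _; apply: aeW => x _; exact: Fg.
- by rewrite inE/= in_itv/= ltrBlDr ltrDl ltr01.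
Qed.

Lemma continuous_cosT g : decays g -> continuous (cosT g).
Proof.
move=> dg; apply: (continuous_param_integral (g := g)) => //.
- by move=> xi; exact: decays_cos.
- move=> x; apply: (is_derive_continuous
    (f' := fun xi => g x * (- sin (2 * pi * x * xi) * (2 * pi * x)))) => xi.
  by apply: is_deriveZ_fun; apply: is_derive_cos_comp; exact: is_derive_linear.
- by move=> xi x; rewrite normrM ler_piMr// norm_cos_le1.
Qed.

Lemma continuous_sinT g : decays g -> continuous (sinT g).
Proof.
move=> dg; apply: (continuous_param_integral (g := g)) => //.
- by move=> xi; exact: decays_sin.
- move=> x; apply: (is_derive_continuous
    (f' := fun xi => g x * (cos (2 * pi * x * xi) * (2 * pi * x)))) => xi.
  by apply: is_deriveZ_fun; apply: is_derive_sin_comp; exact: is_derive_linear.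
- by move=> xi x; rewrite normrM ler_piMr// norm_sin_le1.
Qed.

Lemma pi2_ge1 : 1 <= 2 * pi :> R.
Proof. by have := @pi_ge2 R; lra. Qed.

(** [T] stands for [cosT] or [sinT]. The integral of |g| bounds |T g|, and that of |g''| bounds (2
    pi xi)^2 |T g|, hence xi^2 |T g|; adding the two gives the quadratic decay. *)
Lemma decays_transform (T : (R -> R) -> R -> R) (g g'' : R -> R) :
  (forall h, decays h -> continuous (T h)) ->
  (forall h xi, decays h -> `|T h xi| <= \int[mu]_x `|h x|) ->
  (forall xi, T g'' xi = - ((2 * pi * xi) ^+ 2 * T g xi)) ->
  decays g -> decays g'' -> decays (T g).
Proof.
move=> cT bT dT dg dg''; split; first exact: cT.
exists (\int[mu]_x `|g x| + \int[mu]_x `|g'' x|) => xi.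
have o0 : 0 < oneDsqr xi := lt_le_trans ltr01 (oneDsqr_ge1 _).
rewrite ler_pdivlMr// /oneDsqr mulrDr mulr1 lerD ?bT//.
have := bT _ xi dg''; rewrite dT normrN normrM; apply: le_trans.
rewrite mulrC ler_wpM2r// ger0_norm ?sqr_ge0// exprMn ler_peMl ?sqr_ge0//.
by rewrite exprn_ege1// pi2_ge1.
Qed.

Lemma decays_cosT (g g' g'' : R -> R) :
  (forall x : R, is_derive x 1 g (g' x)) -> (forall x : R, is_derive x 1 g' (g'' x)) ->
  decays g -> decays g' -> decays g'' -> decays (cosT g).
Proof.
move=> d1 d2 dg dg' dg''; apply: (decays_transform (g'' := g'')) => //.
- exact: continuous_cosT.
- exact: norm_cosT_le.
- by move=> xi; rewrite (cosT_derive _ d2)// (sinT_derive _ d1)//; ring.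
Qed.

Lemma decays_sinT (g g' g'' : R -> R) :
  (forall x : R, is_derive x 1 g (g' x)) -> (forall x : R, is_derive x 1 g' (g'' x)) ->
  decays g -> decays g' -> decays g'' -> decays (sinT g).
Proof.
move=> d1 d2 dg dg' dg''; apply: (decays_transform (g'' := g'')) => //.
- exact: continuous_sinT.
- exact: norm_sinT_le.
- by move=> xi; rewrite (sinT_derive _ d2)// (cosT_derive _ d1)//; ring.
Qed.

End trig_transforms.

(** * Schwartz functions and their transforms *)

Section schwartz.
Context {R : realType}.
Implicit Types (g : R -> R).

Lemma schwartz_is_derive g n (x : R) : schwartzR g ->
  is_derive x 1 (derive1n n g) (derive1n n.+1 g x).
Proof. by move=> [dg _]; apply: DeriveDef; [exact: dg|rewrite derive1nS derive1E]. Qed.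

Lemma schwartz_decays g n : schwartzR g -> decays (derive1n n g).
Proof.
move=> sg; split.
  by apply: is_derive_continuous => x; exact: schwartz_is_derive.
(* The seminorms with weights 1 and x^2 add up to a bound on (1 + x^2) times the derivative. *)
have [C0 h0] := sg.2 0%N n; have [C2 h2] := sg.2 2%N n.
exists (C0 + C2) => x.
have o0 : 0 < oneDsqr x := lt_le_trans ltr01 (oneDsqr_ge1 _).
rewrite ler_pdivlMr// /oneDsqr mulrDr mulr1 lerD//.
  by have := h0 x; rewrite expr0 mul1r.
by rewrite -[x ^+ 2]real_normK ?num_real// mulrC; exact: h2.
Qed.

Lemma schwartz_decays0 g : schwartzR g -> decays g.
Proof. exact: (@schwartz_decays _ 0). Qed.

Lemma schwartz_decays_cosT g : schwartzR g -> decays (cosT g).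
Proof.
move=> sg; apply: (decays_cosT (g' := derive1n 1 g) (g'' := derive1n 2 g)).
- by move=> x; exact: (schwartz_is_derive 0).
- by move=> x; exact: (schwartz_is_derive 1).
- exact: schwartz_decays0.
- exact: schwartz_decays.
- exact: schwartz_decays.
Qed.

Lemma schwartz_decays_sinT g : schwartzR g -> decays (sinT g).
Proof.
move=> sg; apply: (decays_sinT (g' := derive1n 1 g) (g'' := derive1n 2 g)).
- by move=> x; exact: (schwartz_is_derive 0).
- by move=> x; exact: (schwartz_is_derive 1).
- exact: schwartz_decays0.
- exact: schwartz_decays.
- exact: schwartz_decays.
Qed.

Lemma schwartzR_lin (a b : R) (g h : R -> R) : schwartzR g -> schwartzR h ->
  schwartzR (fun x => a * g x + b * h x).
Proof.
move=> sg sh.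
have E n : derive1n n (fun x => a * g x + b * h x) =
    (fun x => a * derive1n n g x + b * derive1n n h x).
  elim: n => // n IHn; rewrite derive1nS IHn; apply/funext => x.
  rewrite derive1E; apply: derive_val.
  apply: is_deriveD_fun; apply: is_deriveZ_fun; exact: schwartz_is_derive.
split.
  move=> n x; rewrite E.
  have : is_derive x 1 (fun x => a * derive1n n g x + b * derive1n n h x)
     (a * derive1n n.+1 g x + b * derive1n n.+1 h x).
    apply: is_deriveD_fun; apply: is_deriveZ_fun; exact: schwartz_is_derive.
  by case.
move=> k n; have [C hC] := sg.2 k n; have [D hD] := sh.2 k n.
exists (`|a| * C + `|b| * D) => x; rewrite E.
apply: (@le_trans _ _ (`|x| ^+ k * (`|a| * `|derive1n n g x| + `|b| * `|derive1n n h x|))).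
  by rewrite ler_wpM2l ?exprn_ge0// -!normrM ler_normD.
by rewrite mulrDr !(mulrCA (_ ^+ k)) lerD// ler_wpM2l.
Qed.

End schwartz.

(** * Gaussians and chirps *)

Section transform_derivative.
Context {R : realType}.
Local Notation mu := (@lebesgue_measure R).
Implicit Types (g : R -> R) (x xi : R).

Lemma is_derive_param_integral (F F' : R -> R -> R) g xi0 : decays g ->
  (forall xi, decays (F xi)) ->
  (forall xi x : R, is_derive xi 1 (F ^~ x) (F' xi x)) ->
  (forall xi x, `|F' xi x| <= `|g x|) ->
  is_derive xi0 1 (fun xi => \int[mu]_x F xi x) (\int[mu]_x F' xi0 x).
Proof.
move=> dg dF dFF' F'g.
have I0 : `]xi0 - 1, xi0 + 1[%classic xi0.
  by rewrite /= in_itv/= ltrBlDr ltrDl ltr01.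
have pE xi x : partial1of2 F xi x = F' xi x.
  by rewrite partial1of2E; apply: derive_val.
have iF xi : `]xi0 - 1, xi0 + 1[%classic xi -> mu.-integrable setT (EFin \o F xi).
  by move=> _; exact: integrable_decays.
have dF1 xi x : `]xi0 - 1, xi0 + 1[%classic xi -> setT x -> derivable (F ^~ x) xi 1.
  by move=> _ _; case: (dFF' xi x).
have ig : mu.-integrable setT (EFin \o (fun x => `|g x|)).
  exact: integrable_norm (integrable_decays dg).
have bd xi x : `]xi0 - 1, xi0 + 1[%classic xi -> setT x ->
    `|partial1of2 F xi x| <= `|g x|.
  by move=> _ _; rewrite pE.
have g0 x : 0 <= `|g x| by [].
have := @differentiation_under_integral _ _ _ mu F setT measurableT _ _ _ I0 iF
  dF1 _ g0 ig bd.
have := @derivable_under_integral _ _ _ mu F setT measurableT _ _ _ I0 iF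
  dF1 _ g0 ig bd.
move=> d1; rewrite derive1E => d2; apply: DeriveDef; first exact: d1.
by rewrite d2; apply: eq_Rintegral => x _; rewrite pE.
Qed.

Lemma is_derive_cosT g xi : decays g -> decays (fun x => x * g x) ->
  is_derive xi 1 (cosT g) (- (2 * pi * sinT (fun x => x * g x) xi)).
Proof.
move=> dg dxg; rewrite -mulNr -RintegralZ_decays; last exact: decays_sin.
apply: (@is_derive_param_integral (fun xi x => g x * cos (2 * pi * x * xi))
  (fun xi x => - (2 * pi) * (x * g x * sin (2 * pi * x * xi)))
  (fun x => (2 * pi) * (x * g x))).
- exact: decaysZ.
- by move=> ?; exact: decays_cos.
- move=> {}xi x.
  have -> : - (2 * pi) * (x * g x * sin (2 * pi * x * xi)) =
     g x * (- sin (2 * pi * x * xi) * (2 * pi * x)) by ring.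
  by apply: is_deriveZ_fun; apply: is_derive_cos_comp; exact: is_derive_linear.
- move=> {}xi x; rewrite mulNr normrN !normrM.
  by rewrite ler_wpM2l// ler_piMr// norm_sin_le1.
Qed.

Lemma is_derive_sinT g xi : decays g -> decays (fun x => x * g x) ->
  is_derive xi 1 (sinT g) (2 * pi * cosT (fun x => x * g x) xi).
Proof.
move=> dg dxg; rewrite -RintegralZ_decays; last exact: decays_cos.
apply: (@is_derive_param_integral (fun xi x => g x * sin (2 * pi * x * xi))
  (fun xi x => 2 * pi * (x * g x * cos (2 * pi * x * xi)))
  (fun x => (2 * pi) * (x * g x))).
- exact: decaysZ.
- by move=> ?; exact: decays_sin.
- move=> {}xi x.
  have -> : 2 * pi * (x * g x * cos (2 * pi * x * xi)) =
     g x * (cos (2 * pi * x * xi) * (2 * pi * x)) by ring.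
  by apply: is_deriveZ_fun; apply: is_derive_sin_comp; exact: is_derive_linear.
- move=> {}xi x; rewrite !normrM.
  by rewrite ler_wpM2l// ler_piMr// norm_cos_le1.
Qed.

(** The integrating factor e^{k t^2} turns [Y] into a constant. *)
Lemma gaussian_ode (Y : R -> R) (k : R) :
  (forall xi : R, is_derive xi 1 Y (- (2 * k * xi * Y xi))) ->
  forall xi, Y xi = Y 0 * expR (- k * xi ^+ 2).
Proof.
move=> dY xi; pose W t := Y t * expR (k * t ^+ 2).
have dW (t : R) : is_derive t 1 W 0.
  have -> : 0 = - (2 * k * t * Y t) * expR (k * t ^+ 2)
     + Y t * (expR (k * t ^+ 2) * (k * (2 * t))) by ring.
  by apply: is_deriveM_fun => //; apply: is_derive_expR_comp; exact: is_derive_quadratic.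
have := is_derive_0_is_cst xi 0 dW; rewrite /W expr0n/= mulr0 expR0 mulr1 => <-.
by rewrite -mulrA -expRD mulNr subrr expR0 mulr1.
Qed.

End transform_derivative.

Section gaussian.
Context {R : realType}.
Local Notation mu := (@lebesgue_measure R).
Implicit Types (a b x : R).

Definition gauss a x : R := expR (- (pi * a) * x ^+ 2).

Lemma gauss_gt0 a x : 0 < gauss a x. Proof. exact: expR_gt0. Qed.

Lemma norm_gauss a x : `|gauss a x| = gauss a x.
Proof. by rewrite ger0_norm// ltW// gauss_gt0. Qed.

Lemma gauss_le1 a x : 0 < a -> gauss a x <= 1.
Proof.
move=> a0; rewrite /gauss -expR0 ler_expR mulNr oppr_le0.
by apply: mulr_ge0; [apply: mulr_ge0; [exact: pi_ge0|exact: ltW]|exact: sqr_ge0].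
Qed.

Lemma is_derive_gauss a x : is_derive x 1 (gauss a) (- (2 * pi * a * x) * gauss a x).
Proof.
have -> : - (2 * pi * a * x) * gauss a x = gauss a x * (- (pi * a) * (2 * x)) by ring.
by apply: is_derive_expR_comp; exact: is_derive_quadratic.
Qed.

Lemma monomial_gauss_bounded a k : 0 < a ->
  exists C, forall x, `|x| ^+ k * gauss a x <= C.
Proof.
move=> a0; have pa0 : 0 < pi * a by rewrite mulr_gt0// pi_gt0.
(* From |x|^k <= 1 + (x^2)^(k+1): the Gaussian is at most 1, and t^(k+1) e^{-t} <= (k+1)! for t = pi
   a x^2. *)
exists (1 + (k.+1)`!%:R / (pi * a) ^+ k.+1) => x.
have t0 : 0 <= (pi * a) * x ^+ 2 by rewrite mulr_ge0// ?sqr_ge0// ltW.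
have xk : `|x| ^+ k <= 1 + (x ^+ 2) ^+ k.+1.
  rewrite -[x ^+ 2]real_normK ?num_real// -exprM.
  have [x1|x1] := leP `|x| 1.
    by rewrite (le_trans (exprn_ile1 _ _ x1))// lerDl exprn_ge0.
  apply: (@le_trans _ _ (`|x| ^+ (2 * k.+1))); last by rewrite lerDr.
  by rewrite ler_weXn2l ?(ltW x1)// mul2n -addnn (leq_trans (leqnSn k))// leq_addr.
have g1 := gauss_le1 x a0.
apply: (le_trans (ler_wpM2r (ltW (gauss_gt0 _ _)) xk)).
rewrite mulrDl mul1r lerD// ler_pdivlMr ?exprn_gt0//.
rewrite mulrAC -exprMn (mulrC (x ^+ 2)) /gauss mulNr expRN ler_pdivrMr ?expR_gt0//.
have := expR_ge1Dxn k t0; rewrite -lerBrDl => h.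
have f0 : 0 < (k.+1)`!%:R :> R by rewrite ltr0n fact_gt0.
rewrite -ler_pdivrMl// [leLHS]mulrC (le_trans h)//.
by rewrite gerBl.
Qed.

Lemma poly_gauss_bounded a (P : {poly R}) k : 0 < a ->
  exists C, forall x, `|x| ^+ k * (`|P.[x]| * gauss a x) <= C.
Proof.
move=> a0; elim/poly_ind: P k => [|P c IH] k.
  by exists 0 => x; rewrite horner0 normr0 mul0r mulr0.
have [C hC] := IH k.+1; have [D hD] := monomial_gauss_bounded k a0.
exists (C + `|c| * D) => x; rewrite hornerMXaddC.
apply: (@le_trans _ _ (`|x| ^+ k * ((`|P.[x]| * `|x| + `|c|) * gauss a x))).
  rewrite ler_wpM2l ?exprn_ge0// ler_wpM2r ?(ltW (gauss_gt0 _ _))//.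
  by rewrite (le_trans (ler_normD _ _))// normrM.
have -> : `|x| ^+ k * ((`|P.[x]| * `|x| + `|c|) * gauss a x) =
  `|x| ^+ k.+1 * (`|P.[x]| * gauss a x) + `|c| * (`|x| ^+ k * gauss a x).
  by rewrite exprS; ring.
by rewrite lerD// ler_wpM2l.
Qed.

(** Polynomial multiples of the real and imaginary parts of a chirp. The family is closed under
    differentiation, so the Schwartz bounds follow from the mere existence of polynomials for each
    iterated derivative. *)
Definition pchirp a b (P Q : {poly R}) x : R :=
  P.[x] * (gauss a x * cos (pi * b * x ^+ 2)) +
  Q.[x] * (gauss a x * sin (pi * b * x ^+ 2)).

Lemma is_derive_pchirp a b (P Q : {poly R}) x :
  is_derive x 1 (pchirp a b P Q)
    (pchirp a b (P^`() - (2 * pi * a) *: ('X * P) + (2 * pi * b) *: ('X * Q))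
                (Q^`() - (2 * pi * a) *: ('X * Q) - (2 * pi * b) *: ('X * P)) x).
Proof.
have -> : pchirp a b (P^`() - (2 * pi * a) *: ('X * P) + (2 * pi * b) *: ('X * Q))
                (Q^`() - (2 * pi * a) *: ('X * Q) - (2 * pi * b) *: ('X * P)) x =
  (P^`().[x] * (gauss a x * cos (pi * b * x ^+ 2)) +
   P.[x] * (- (2 * pi * a * x) * gauss a x * cos (pi * b * x ^+ 2)
     + gauss a x * (- sin (pi * b * x ^+ 2) * (pi * b * (2 * x))))) +
  (Q^`().[x] * (gauss a x * sin (pi * b * x ^+ 2)) +
   Q.[x] * (- (2 * pi * a * x) * gauss a x * sin (pi * b * x ^+ 2)
     + gauss a x * (cos (pi * b * x ^+ 2) * (pi * b * (2 * x))))).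
  by rewrite /pchirp !(hornerD, hornerN, hornerZ, hornerM, hornerX); ring.
apply: is_deriveD_fun; apply: is_deriveM_fun.
- apply: is_deriveM_fun; first exact: is_derive_gauss.
  by apply: is_derive_cos_comp; exact: is_derive_quadratic.
- apply: is_deriveM_fun; first exact: is_derive_gauss.
  by apply: is_derive_sin_comp; exact: is_derive_quadratic.
Qed.

Lemma schwartz_pchirp a b (P Q : {poly R}) : 0 < a -> schwartzR (pchirp a b P Q).
Proof.
move=> a0.
have E n : exists PQ : {poly R} * {poly R},
    derive1n n (pchirp a b P Q) = pchirp a b PQ.1 PQ.2.
  elim: n => [|n [PQ IH]]; first by exists (P, Q).
  exists (PQ.1^`() - (2 * pi * a) *: ('X * PQ.1) + (2 * pi * b) *: ('X * PQ.2),
          PQ.2^`() - (2 * pi * a) *: ('X * PQ.2) - (2 * pi * b) *: ('X * PQ.1)).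
  rewrite derive1nS IH; apply/funext => x; rewrite derive1E.
  by apply: derive_val; exact: is_derive_pchirp.
split.
  by move=> n x; have [PQ ->] := E n; case: (is_derive_pchirp a b PQ.1 PQ.2 x).
move=> k n; have [[P' Q'] ->] := E n => /=.
have [C hC] := poly_gauss_bounded P' k a0; have [D hD] := poly_gauss_bounded Q' k a0.
exists (C + D) => x; rewrite /pchirp.
apply: (le_trans (ler_wpM2l _ (ler_normD _ _))); first exact: exprn_ge0.
rewrite mulrDr lerD//.
- apply: le_trans (hC x); rewrite ler_wpM2l ?exprn_ge0// normrM ler_wpM2l//.
  by rewrite normrM norm_gauss ler_piMr ?norm_cos_le1// ltW// gauss_gt0.
- apply: le_trans (hD x); rewrite ler_wpM2l ?exprn_ge0// normrM ler_wpM2l//.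
  by rewrite normrM norm_gauss ler_piMr ?norm_sin_le1// ltW// gauss_gt0.
Qed.

End gaussian.

(** * Integrals and norms of Gaussians *)

Section gauss_norms.
Context {R : realType}.
Local Notation mu := (@lebesgue_measure R).
Implicit Types (a m x : R).

Lemma gauss0 a : gauss a 0 = 1.
Proof. by rewrite /gauss expr0n/= mulr0 expR0. Qed.

Lemma integral_gauss_shift a m : 0 < a ->
  (\int[mu]_x (gauss a (x - m))%:E)%E = ((Num.sqrt a)^-1)%:E.
Proof.
move=> a0; have pa0 : 0 < 2 * pi * a by rewrite !mulr_gt0// pi_gt0.
(* The standard deviation for which (x - m)^2 / (2 s^2) = pi a (x - m)^2: the Gaussian is then a
   normal density up to the factor sqrt(a), and that density has total mass 1. *)
pose s := (Num.sqrt (2 * pi * a))^-1.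
have s0 : s != 0 by rewrite invr_eq0 gt_eqF// sqrtr_gt0.
have s2 : s ^+ 2 = (2 * pi * a)^-1 by rewrite /s exprVn sqr_sqrtr// ltW.
have pi0 : pi != 0 :> R by rewrite gt_eqF// pi_gt0.
have an0 : a != 0 by rewrite gt_eqF.
have sa0 : 0 < Num.sqrt a by rewrite sqrtr_gt0.
have pE x : normal_pdf m s x = Num.sqrt a * gauss a (x - m).
  rewrite normal_pdfE// /normal_peak /normal_fun s2; congr (_ * expR _).
  - have -> : (2 * pi * a)^-1 * pi *+ 2 = a^-1.
      by rewrite -mulr_natr; move: pi0; move: (pi : R) => P P0; field; rewrite an0 P0.
    by rewrite sqrtrV ?(ltW a0)// invrK.
  - by rewrite -mulr_natr; move: pi0; move: (pi : R) => P P0; field; rewrite an0 P0.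
have := integral_normal_pdf m s.
under eq_integral do rewrite pE EFinM.
rewrite ge0_integralZl_EFin//; last first.
- apply/measurable_EFinP; apply: continuous_measurable_fun.
  apply: (is_derive_continuous
    (f' := fun x => - (2 * pi * a * (x - m)) * gauss a (x - m) * 1)) => x.
  apply: (@is_derive1_comp _ (gauss a) (fun x => x - m)).
  exact: is_derive_gauss.
  rewrite -[X in is_derive _ _ _ X]addr0.
  by apply: is_deriveD_fun.
- by move=> x _; rewrite lee_fin (ltW (gauss_gt0 _ _)).
move=> h.
have /(congr1 (fun z => ((Num.sqrt a)^-1)%:E * z)%E) := h.
by rewrite muleA -EFinM mulVf ?mul1e ?mule1// gt_eqF.
Qed.

Lemma integral_gauss a : 0 < a ->
  (\int[mu]_x (gauss a x)%:E)%E = ((Num.sqrt a)^-1)%:E.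
Proof.
move=> a0; rewrite -(integral_gauss_shift 0 a0).
by apply: eq_integral => x _; rewrite subr0.
Qed.

Lemma schwartz_gauss a : 0 < a -> schwartzR (gauss a).
Proof.
move=> a0; have := schwartz_pchirp 0 1 0 a0; congr schwartzR; apply/funext => x.
by rewrite /pchirp hornerC horner0 mul0r addr0 mul1r mulr0 mul0r cos0 mulr1.
Qed.

Lemma decays_gauss a : 0 < a -> decays (gauss a).
Proof. by move=> a0; apply: schwartz_decays0; exact: schwartz_gauss. Qed.

(** The r-th power of [gauss a] is [gauss (a * r)], whose integral is known. *)
Lemma NL_gauss (r : R) a : 1 <= r -> 0 < a ->
  NL r%:E (gauss a) = ((Num.sqrt (a * r))^-1) `^ r^-1.
Proof.
move=> r1 a0; have r0 : 0 < r by rewrite (lt_le_trans ltr01).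
rewrite /NL unlock.
have -> : (\int[mu]_x `|(EFin \o gauss a) x| `^ r)%E = ((Num.sqrt (a * r))^-1)%:E.
  rewrite -integral_gauss ?mulr_gt0//; apply: eq_integral => x _.
  rewrite /= norm_gauss /gauss -expRM; congr (expR _)%:E; ring.
by rewrite poweR_EFin.
Qed.

Lemma NLy_gauss a : 0 < a -> NL +oo (gauss a) = 1.
Proof.
move=> a0; apply/eqP; rewrite eq_le; apply/andP; split; last first.
  by have := normr_le_NLy 0 (decays_gauss a0); rewrite norm_gauss gauss0.
rewrite -lee_fin NLK ?leey//; last exact: decays_gauss.
rewrite unlock mu_setT_gt0; apply/ess_supP; apply: nearW => x /=.
by rewrite lee_fin norm_gauss gauss_le1.
Qed.

(** The convention 1/oo = 0, under which the scaling law below covers finite and infinite exponents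
    alike. *)
Definition inv_exponent (r : \bar R) : R := if r is r'%:E then r'^-1 else 0.

Lemma sqrtr_expR4 (s : R) : Num.sqrt (expR (4 * s)) = expR (2 * s).
Proof.
have -> : 4 * s = 2 * s + 2 * s by ring.
by rewrite expRD -expr2 sqrtr_sqr ger0_norm// ltW// expR_gt0.
Qed.

Lemma NL_gauss_scale (r : \bar R) : (1 <= r)%E ->
  exists2 k : R, 0 < k & forall s : R,
    NL r (gauss (expR (4 * s))) = k * expR (- (2 * s * inv_exponent r)).
Proof.
case: r => [r| |]// r1; last first.
  exists 1 => // s; rewrite NLy_gauss ?expR_gt0//=.
  by rewrite mulr0 oppr0 expR0 mulr1.
have r0 : 0 < r by rewrite (lt_le_trans ltr01).
exists ((Num.sqrt r)^-1 `^ r^-1) => [|s].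
  by rewrite powR_gt0// invr_gt0 sqrtr_gt0.
rewrite NL_gauss// ?expR_gt0// sqrtrM ?(ltW (expR_gt0 _))//.
rewrite sqrtr_expR4 invfM powRM ?invr_ge0 ?sqrtr_ge0 ?(ltW (expR_gt0 _))// mulrC; congr (_ * _).
by rewrite -expRN -expRM /=; congr expR; ring.
Qed.

End gauss_norms.

(** * The differential equation of a transformed chirp *)

Section chirp_transform.
Context {R : realType}.
Local Notation mu := (@lebesgue_measure R).
Implicit Types (f : cfun R) (a b x xi : R).

Lemma fourier1E f xi : decays f.1 -> decays f.2 ->
  (fourier f).1 xi = cosT f.1 xi + sinT f.2 xi.
Proof.
move=> d1 d2; rewrite /= RintegralD_decays//; first exact: decays_cos.
exact: decays_sin.
Qed.

Lemma fourier2E f xi : decays f.1 -> decays f.2 ->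
  (fourier f).2 xi = cosT f.2 xi - sinT f.1 xi.
Proof.
move=> d1 d2; rewrite /= RintegralB//; apply: integrable_decays.
- exact: decays_cos.
- exact: decays_sin.
Qed.

(* [e^(-pi (a + i b) x^2)] as a pair (real part, imaginary part). *)
Definition chirp a b : cfun R :=
  (fun x => gauss a x * cos (pi * b * x ^+ 2),
   fun x => - (gauss a x * sin (pi * b * x ^+ 2))).

Lemma chirp1E a b : (chirp a b).1 = pchirp a b 1 0.
Proof.
by apply/funext => x; rewrite /pchirp hornerC horner0 mul0r addr0 mul1r.
Qed.

Lemma chirp2E a b : (chirp a b).2 = pchirp a b 0 (- 1).
Proof.
by apply/funext => x; rewrite /pchirp horner0 hornerN hornerC mul0r add0r mulN1r.
Qed.

Lemma schwartz_chirp a b : 0 < a -> schwartz (chirp a b).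
Proof.
by move=> a0; split; rewrite ?chirp1E ?chirp2E; exact: schwartz_pchirp.
Qed.

Lemma cmod_chirp a b : cmod (chirp a b) = gauss a.
Proof.
apply/funext => x; rewrite /cmod /= sqrrN !exprMn -mulrDr cos2Dsin2 mulr1.
by rewrite sqrtr_sqr norm_gauss.
Qed.

(* The transform of [e^(-pi z x^2)] solves [z Y' = - 2 pi xi Y]; below are the real and imaginary
   parts of that equation multiplied by the conjugate of [z = a + i b]. *)
Lemma chirp_transform_ode a b xi : 0 < a ->
  let A := (fourier (chirp a b)).1 in let B := (fourier (chirp a b)).2 in
  let k := pi / (a ^+ 2 + b ^+ 2) in
  is_derive xi 1 A (- (2 * k * xi * (a * A xi + b * B xi))) /\
  is_derive xi 1 B (- (2 * k * xi * (a * B xi - b * A xi))).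
Proof.
move=> a0 A B k.
have [s1 s2] := schwartz_chirp b a0.
set f1 := (chirp a b).1 in s1; set f2 := (chirp a b).2 in s2.
have d1 := schwartz_decays0 s1; have d2 := schwartz_decays0 s2.
pose x1 x := x * f1 x; pose x2 x := x * f2 x.
have dx1 : decays x1.
  have -> : x1 = pchirp a b 'X 0.
    by apply/funext => x; rewrite /x1 /f1 /pchirp hornerX horner0 mul0r addr0.
  by apply: schwartz_decays0; exact: schwartz_pchirp.
have dx2 : decays x2.
  have -> : x2 = pchirp a b 0 (- 'X).
    apply/funext => x; rewrite /x2 /f2 /pchirp hornerN hornerX horner0 mul0r add0r.
    by rewrite mulrN mulNr.
  by apply: schwartz_decays0; exact: schwartz_pchirp.
(* [f1'] and [f2'] are the real and imaginary parts of - 2 pi z x f, the derivative of the chirp. *)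
pose f1' x := (- (2 * pi * a)) * x1 x + (2 * pi * b) * x2 x.
pose f2' x := (- (2 * pi * a)) * x2 x + (- (2 * pi * b)) * x1 x.
have df1 (x : R) : is_derive x 1 f1 (f1' x).
  have -> : f1' x = - (2 * pi * a * x) * gauss a x * cos (pi * b * x ^+ 2)
     + gauss a x * (- sin (pi * b * x ^+ 2) * (pi * b * (2 * x))).
    by rewrite /f1' /x1 /x2 /f1 /f2 /=; ring.
  apply: is_deriveM_fun; first exact: is_derive_gauss.
  by apply: is_derive_cos_comp; exact: is_derive_quadratic.
have df2 (x : R) : is_derive x 1 f2 (f2' x).
  have -> : f2' x = - (- (2 * pi * a * x) * gauss a x * sin (pi * b * x ^+ 2)
     + gauss a x * (cos (pi * b * x ^+ 2) * (pi * b * (2 * x)))).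
    by rewrite /f2' /x1 /x2 /f1 /f2 /=; ring.
  have -> : f2 = - (fun x => gauss a x * sin (pi * b * x ^+ 2)) by [].
  apply: is_deriveN; apply: is_deriveM_fun; first exact: is_derive_gauss.
  by apply: is_derive_sin_comp; exact: is_derive_quadratic.
have df1' : decays f1' by apply: decaysD; exact: decaysZ.
have df2' : decays f2' by apply: decaysD; exact: decaysZ.
have AE : A = (fun xi => cosT f1 xi + sinT f2 xi).
  by apply/funext => t; rewrite /A fourier1E.
have BE : B = (fun xi => cosT f2 xi + (- 1) * sinT f1 xi).
  by apply/funext => t; rewrite /B fourier2E// mulN1r.
have z0 : a ^+ 2 + b ^+ 2 != 0.
  by rewrite gt_eqF// ltr_pwDl ?sqr_ge0// exprn_gt0.
have pi0 : pi != 0 :> R by rewrite gt_eqF// pi_gt0.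
have := cosT_derive xi df1 d1 df1'; rewrite cosTD ?cosTZ//; try exact: decaysZ.
have := sinT_derive xi df1 d1 df1'; rewrite sinTD ?sinTZ//; try exact: decaysZ.
have := cosT_derive xi df2 d2 df2'; rewrite cosTD ?cosTZ//; try exact: decaysZ.
have := sinT_derive xi df2 d2 df2'; rewrite sinTD ?sinTZ//; try exact: decaysZ.
move=> e4 e3 e2 e1.
have dA : is_derive xi 1 A (- (2 * pi * sinT x1 xi) + 2 * pi * cosT x2 xi).
  by rewrite AE; apply: is_deriveD_fun; [exact: is_derive_cosT|exact: is_derive_sinT].
have dB : is_derive xi 1 B (- (2 * pi * sinT x2 xi) + (- 1) * (2 * pi * cosT x1 xi)).
  rewrite BE; apply: is_deriveD_fun; first exact: is_derive_cosT.
  by apply: is_deriveZ_fun; exact: is_derive_sinT.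
have linA : (a ^+ 2 + b ^+ 2) * (- (2 * pi * sinT x1 xi) + 2 * pi * cosT x2 xi) =
   - (2 * pi * xi * (a * A xi + b * B xi)).
  (* The combination of the four integrations by parts [e1] to [e4] that amounts to multiplying the
     complex equation by the conjugate of z; it isolates the derivative of [A], and its analogue
     below that of [B]. *)
  transitivity
   (a * (- (2 * pi * a) * sinT x1 xi + 2 * pi * b * sinT x2 xi)
    + b * (- (2 * pi * a) * sinT x2 xi + - (2 * pi * b) * sinT x1 xi)
    + b * (- (2 * pi * a) * cosT x1 xi + 2 * pi * b * cosT x2 xi)
    - a * (- (2 * pi * a) * cosT x2 xi + - (2 * pi * b) * cosT x1 xi)); first by ring.
  by rewrite e1 e2 e3 e4 AE BE; ring.
have linB : (a ^+ 2 + b ^+ 2) *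
   (- (2 * pi * sinT x2 xi) + (- 1) * (2 * pi * cosT x1 xi)) =
   - (2 * pi * xi * (a * B xi - b * A xi)).
  transitivity
   (a * (- (2 * pi * a) * sinT x2 xi + - (2 * pi * b) * sinT x1 xi)
    - b * (- (2 * pi * a) * sinT x1 xi + 2 * pi * b * sinT x2 xi)
    + a * (- (2 * pi * a) * cosT x1 xi + 2 * pi * b * cosT x2 xi)
    + b * (- (2 * pi * a) * cosT x2 xi + - (2 * pi * b) * cosT x1 xi)); first by ring.
  by rewrite e1 e2 e3 e4 AE BE; ring.
split.
- have -> : - (2 * k * xi * (a * A xi + b * B xi)) =
    - (2 * pi * sinT x1 xi) + 2 * pi * cosT x2 xi; last exact: dA.
  by apply: (mulfI z0); rewrite linA /k; field.
- have -> : - (2 * k * xi * (a * B xi - b * A xi)) =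
    - (2 * pi * sinT x2 xi) + (- 1) * (2 * pi * cosT x1 xi); last exact: dB.
  by apply: (mulfI z0); rewrite linB /k; field.
Qed.

End chirp_transform.

(** * Injectivity of the Fourier transform *)

Section gaussian_transforms.
Context {R : realType}.
Local Notation mu := (@lebesgue_measure R).
Implicit Types (a b x xi : R).

(** At b = 0 the equation of the chirp becomes a scalar one for the cosine transform, with the
    Gaussian integral as initial value. *)
Lemma cosT_gauss a xi : 0 < a ->
  cosT (gauss a) xi = (Num.sqrt a)^-1 * gauss a^-1 xi.
Proof.
move=> a0; have an0 : a != 0 by rewrite gt_eqF.
have f1E : (chirp a 0).1 = gauss a.
  by apply/funext => x; rewrite /= mulr0 mul0r cos0 mulr1.
have f2E : (chirp a 0).2 = (fun=> 0).
  by apply/funext => x; rewrite /= mulr0 mul0r sin0 mulr0 oppr0.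
have d1 := decays_gauss a0.
have d2 := @decays0 R.
have AE : (fourier (chirp a 0)).1 = cosT (gauss a).
  apply/funext => t; have := @fourier1E _ (chirp a 0) t.
  by rewrite f1E f2E => /(_ d1 d2) ->; rewrite sinT0 addr0.
have ode (t : R) : is_derive t 1 (cosT (gauss a))
    (- (2 * (pi / a) * t * cosT (gauss a) t)).
  have [dA _] := chirp_transform_ode 0 t a0; move: dA; rewrite AE mul0r addr0 expr0n addr0.
  congr is_derive; congr (- _); move: (pi : R) => P; by field.
rewrite (gaussian_ode ode) /gauss mulNr; congr (_ * expR (- (_ * _))).
have -> : cosT (gauss a) 0 = \int[mu]_x gauss a x.
  by apply: eq_Rintegral => x _; rewrite mulr0 cos0 mulr1.
by rewrite /Rintegral integral_gauss.
Qed.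

(** The sine transform solves the same scalar equation as the cosine transform, with initial value
    0. *)
Lemma sinT_gauss a xi : 0 < a -> sinT (gauss a) xi = 0.
Proof.
move=> a0; have an0 : a != 0 by rewrite gt_eqF.
have d1 := decays_gauss a0.
have dx : decays (fun x => x * gauss a x).
  have -> : (fun x => x * gauss a x) = pchirp a 0 'X 0.
    apply/funext => x; rewrite /pchirp horner0 hornerX mulr0 !mul0r.
    by rewrite cos0 mulr1 addr0.
  by apply: schwartz_decays0; exact: schwartz_pchirp.
pose g' x := - (2 * pi * a) * (x * gauss a x).
have dg (x : R) : is_derive x 1 (gauss a) (g' x).
  have -> : g' x = - (2 * pi * a * x) * gauss a x by rewrite /g'; ring.
  exact: is_derive_gauss.
have ode (t : R) : is_derive t 1 (sinT (gauss a))
    (- (2 * (pi / a) * t * sinT (gauss a) t)).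
  have e := cosT_derive t dg d1 (decaysZ _ dx).
  rewrite cosTZ// in e.
  have -> : - (2 * (pi / a) * t * sinT (gauss a) t) =
      2 * pi * cosT (fun x => x * gauss a x) t; last exact: is_derive_sinT.
    apply: (mulfI an0).
    have -> : a * (2 * pi * cosT (fun x => x * gauss a x) t) =
       - (- (2 * pi * a) * cosT (fun x => x * gauss a x) t) by ring.
    by rewrite e; move: (pi : R) => P; field.
rewrite (gaussian_ode ode).
have -> : sinT (gauss a) 0 = 0; last by rewrite mul0r.
rewrite /sinT; under eq_Rintegral do rewrite mulr0 sin0 mulr0.
by rewrite Rintegral_cst// mul0r.
Qed.

(** In the derivative of A^2 + B^2 the terms with [b] cancel, leaving a scalar equation for the
    squared modulus; the phase of the transform is never computed. The factor [c] may stay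
    unspecified because it cancels in F. *)
Lemma cmod_fourier_chirp a b : 0 < a -> exists2 c, 0 <= c &
  forall xi, cmod (fourier (chirp a b)) xi = c * gauss (a / (a ^+ 2 + b ^+ 2)) xi.
Proof.
move=> a0; set A := (fourier (chirp a b)).1; set B := (fourier (chirp a b)).2.
have z0 : a ^+ 2 + b ^+ 2 != 0.
  by rewrite gt_eqF// ltr_pwDl ?sqr_ge0// exprn_gt0.
pose k := pi / (a ^+ 2 + b ^+ 2).
pose Y t := A t * A t + B t * B t.
have ode (t : R) : is_derive t 1 Y (- (2 * (2 * (k * a)) * t * Y t)).
  have [dA dB] := chirp_transform_ode b t a0.
  have -> : - (2 * (2 * (k * a)) * t * Y t) =
    (- (2 * k * t * (a * A t + b * B t)) * A t
     + A t * - (2 * k * t * (a * A t + b * B t)))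
   + (- (2 * k * t * (a * B t - b * A t)) * B t
     + B t * - (2 * k * t * (a * B t - b * A t))) by rewrite /Y; ring.
  by apply: is_deriveD_fun; apply: is_deriveM_fun.
exists (Num.sqrt (Y 0)) => [|xi]; first exact: sqrtr_ge0.
have -> : cmod (fourier (chirp a b)) xi = Num.sqrt (Y xi).
  by rewrite /cmod /Y !expr2.
rewrite (gaussian_ode ode) sqrtrM; last by rewrite /Y -!expr2 addr_ge0 ?sqr_ge0.
congr (_ * _).
have -> : - (2 * (k * a)) * xi ^+ 2 = - (k * a) * xi ^+ 2 + - (k * a) * xi ^+ 2 by ring.
rewrite expRD -expr2 sqrtr_sqr ger0_norm ?(ltW (expR_gt0 _))//.
have -> : k * a = pi * (a / (a ^+ 2 + b ^+ 2)); last by [].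
by rewrite /k -mulrA; congr (_ * _); exact: mulrC.
Qed.

End gaussian_transforms.

(** * Gaussian averages and uniqueness *)

Section uniqueness.
Context {R : realType}.
Local Notation mu := (@lebesgue_measure R).
Implicit Types (a b x y xi : R) (g f : R -> R).

Lemma integrable_prod_decays g1 g2 : decays g1 -> decays g2 ->
  (mu \x mu)%E.-integrable setT (fun z : R * R => (g1 z.1 * g2 z.2)%:E).
Proof.
move=> d1 d2; have m1 := measurable_decays d1; have m2 := measurable_decays d2.
have mG : measurable_fun setT (fun z : R * R => g1 z.1 * g2 z.2).
  by apply: measurable_funM; [exact: (measurableT_comp m1)|exact: (measurableT_comp m2)].
apply/integrable12ltyP; first exact/measurable_EFinP.
have i1 := integrable_norm (integrable_decays d1).
have i2 := integrable_norm (integrable_decays d2).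
have M2 : (\int[mu]_y (`|g2 y|)%:E < +oo)%E.
  have /integrableP[_] := integrable_decays d2; by [].
have M1 : (\int[mu]_y (`|g1 y|)%:E < +oo)%E.
  have /integrableP[_] := integrable_decays d1; by [].
have inner x : (\int[mu]_y `|(g1 (x, y).1 * g2 (x, y).2)%:E| =
    (`|g1 x|)%:E * \int[mu]_y (`|g2 y|)%:E)%E.
  rewrite -ge0_integralZl_EFin//.
  - by apply: eq_integral => y _; rewrite /= normrM EFinM.
  - by apply/measurable_EFinP; apply: measurableT_comp.
under eq_integral do rewrite inner.
rewrite ge0_integralZr//.
- by rewrite lte_mul_pinfty// ?integral_ge0// ge0_fin_numE// integral_ge0.
- by apply/measurable_EFinP; apply: measurableT_comp.
- by apply: integral_ge0.
Qed.

Lemma Rintegral_Fubini (H : R -> R -> R) (g1 g2 : R -> R) : decays g1 -> decays g2 ->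
  measurable_fun setT (fun z : R * R => H z.1 z.2) ->
  (forall x y, `|H x y| <= `|g1 x * g2 y|) ->
  (forall x, decays (H x)) -> (forall y, decays (H ^~ y)) ->
  \int[mu]_x (\int[mu]_y H x y) = \int[mu]_y (\int[mu]_x H x y).
Proof.
move=> d1 d2 mH Hg dHx dHy.
have iH : (mu \x mu)%E.-integrable setT (fun z : R * R => (H z.1 z.2)%:E).
  apply: le_integrable (integrable_prod_decays d1 d2) => //.
  - exact/measurable_EFinP.
  - by move=> z _; rewrite /= lee_fin.
have := Fubini iH; rewrite /= => E.
rewrite /Rintegral; congr fine.
transitivity (\int[mu]_x \int[mu]_y (H x y)%:E)%E.
  apply: eq_integral => x _; rewrite fineK//.
  exact: (integrable_fin_num _ (integrable_decays (dHx x))).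
rewrite E; apply: eq_integral => y _; rewrite fineK//.
exact: (integrable_fin_num _ (integrable_decays (dHy y))).
Qed.

Lemma integrable_gauss_shift a y : 0 < a ->
  mu.-integrable setT (EFin \o (fun x => gauss a (x - y))).
Proof.
move=> a0; apply/integrableP; split.
  apply/measurable_EFinP; apply: continuous_measurable_fun => x.
  apply: continuous_comp; last exact: (decays_gauss a0).1.
  by apply: cvgB; [exact: cvg_id|exact: cvg_cst].
under eq_integral do rewrite /= norm_gauss.
by rewrite integral_gauss_shift// ltry.
Qed.

Lemma decays_gauss_shift a y f : 0 < a -> decays f ->
  decays (fun x => f x * gauss a (x - y)).
Proof.
move=> a0 df; apply: decaysM => //.
- move=> x; apply: continuous_comp; last exact: (decays_gauss a0).1.
  by apply: cvgB; [exact: cvg_id|exact: cvg_cst].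
- by move=> x; rewrite norm_gauss gauss_le1.
Qed.

Lemma decays_normr f : decays f -> decays (fun x => `|f x|).
Proof.
move=> [cf [C fC]]; split; first exact: continuous_normr_comp.
by exists C => x; rewrite normr_id.
Qed.

(** [H xi x] is the real part of f(x) e^{-2 pi i (x - y) xi}, weighted by a Gaussian in xi.
    Integrated in x first, it gives the real part of e^{2 pi i y xi} \hat f(xi), which is 0; in xi
    first, it gives a positive multiple of f1(x) [gauss a (x - y)]. Fubini equates the two. *)
Lemma gauss_average_eq0 (f1 f2 : R -> R) a y : 0 < a -> decays f1 -> decays f2 ->
  (forall xi, cosT f1 xi + sinT f2 xi = 0) ->
  (forall xi, cosT f2 xi - sinT f1 xi = 0) ->
  \int[mu]_x (f1 x * gauss a (x - y)) = 0.
Proof.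
move=> a0 d1 d2 A0 B0; pose b := a^-1.
have b0 : 0 < b by rewrite invr_gt0.
have dg := decays_gauss b0.
pose H xi x := gauss b xi * (f1 x * cos (2 * pi * (x - y) * xi)
                             + f2 x * sin (2 * pi * (x - y) * xi)).
have phase xi x : 2 * pi * (x - y) * xi = 2 * pi * x * xi - 2 * pi * y * xi by ring.
have HE xi : H xi = (fun x => gauss b xi * (
    cos (2 * pi * y * xi) * (f1 x * cos (2 * pi * x * xi) + f2 x * sin (2 * pi * x * xi))
  - sin (2 * pi * y * xi) * (f2 x * cos (2 * pi * x * xi) - f1 x * sin (2 * pi * x * xi)))).
  by apply/funext => x; rewrite /H !phase cosB sinB; congr (_ * _); ring.
have dA xi : decays (fun x => f1 x * cos (2 * pi * x * xi) + f2 x * sin (2 * pi * x * xi)).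
  by apply: decaysD; [exact: decays_cos|exact: decays_sin].
have dB xi : decays (fun x => f2 x * cos (2 * pi * x * xi) - f1 x * sin (2 * pi * x * xi)).
  by apply: decaysD; [exact: decays_cos|exact/decaysN/decays_sin].
have dH xi : decays (H xi).
  rewrite HE; apply: decaysZ; apply: decaysD; first exact: decaysZ.
  by apply: decaysN; exact: decaysZ.
have HE' x : H ^~ x = (fun xi =>
    f1 x * (gauss b xi * cos (2 * pi * xi * (x - y)))
  + f2 x * (gauss b xi * sin (2 * pi * xi * (x - y)))).
  by apply/funext => xi; rewrite /H !(mulrAC _ (x - y)); ring.
have dH' x : decays (H ^~ x).
  rewrite HE'; apply: decaysD; apply: decaysZ; [exact: decays_cos|exact: decays_sin].
have inner0 xi : \int[mu]_x H xi x = 0.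
  rewrite HE RintegralZ_decays; last first.
    by apply: decaysD; [exact: decaysZ|apply: decaysN; exact: decaysZ].
  have -> : (fun x =>
    cos (2 * pi * y * xi) * (f1 x * cos (2 * pi * x * xi) + f2 x * sin (2 * pi * x * xi))
  - sin (2 * pi * y * xi) * (f2 x * cos (2 * pi * x * xi) - f1 x * sin (2 * pi * x * xi))) =
   (fun x =>
    cos (2 * pi * y * xi) * (f1 x * cos (2 * pi * x * xi) + f2 x * sin (2 * pi * x * xi))
  + - sin (2 * pi * y * xi) * (f2 x * cos (2 * pi * x * xi) - f1 x * sin (2 * pi * x * xi))).
    by apply/funext => x; rewrite mulNr.
  rewrite RintegralD_decays; [|exact: decaysZ..].
  rewrite !RintegralZ_decays//.
  rewrite RintegralD_decays; [|exact: decays_cos|exact: decays_sin].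
  rewrite RintegralB//; [|exact/integrable_decays/decays_cos|exact/integrable_decays/decays_sin].
  by have := A0 xi; have := B0 xi; rewrite /cosT /sinT => -> ->; rewrite !mulr0 addr0 mulr0.
have inner1 x : \int[mu]_xi H xi x = (Num.sqrt b)^-1 * (f1 x * gauss a (x - y)).
  rewrite -/((H ^~ x) _) HE' RintegralD_decays.
  - rewrite !RintegralZ_decays; [|exact: decays_sin|exact: decays_cos].
    have := cosT_gauss (x - y) b0; have := sinT_gauss (x - y) b0.
    by rewrite /cosT /sinT => -> ->; rewrite mulr0 addr0 /b invrK mulrCA.
  - by apply: decaysZ; exact: decays_cos.
  - by apply: decaysZ; exact: decays_sin.
have := @Rintegral_Fubini H (gauss b) (fun x => `|f1 x| + `|f2 x|).
have dsum : decays (fun x => `|f1 x| + `|f2 x|).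
  by apply: decaysD; exact: decays_normr.
move=> /(_ dg dsum) FH.
have mH : measurable_fun setT (fun z : R * R => H z.1 z.2).
  have mph : measurable_fun setT (fun z : R * R => 2 * pi * (z.2 - y) * z.1).
    by apply: measurable_funM => //; apply: measurable_funM => //; exact: measurable_funB.
  have mc : measurable_fun setT (@cos R).
    by apply: continuous_measurable_fun; exact: continuous_cos.
  have ms : measurable_fun setT (@sin R).
    by apply: continuous_measurable_fun; exact: continuous_sin.
  apply: measurable_funM.
    exact: (measurableT_comp (measurable_decays dg)).
  apply: measurable_funD; apply: measurable_funM.
  - exact: (measurableT_comp (measurable_decays d1)).
  - exact: (measurableT_comp mc).
  - exact: (measurableT_comp (measurable_decays d2)).
  - exact: (measurableT_comp ms).
have bH xi x : `|H xi x| <= `|gauss b xi * (`|f1 x| + `|f2 x|)|.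
  have n0 : 0 <= `|f1 x| + `|f2 x| by exact: addr_ge0.
  rewrite [leLHS]normrM [leRHS]normrM (ger0_norm n0); apply: ler_wpM2l => //.
  apply: (le_trans (ler_normD _ _)); rewrite normrM [X in _ + X]normrM.
  by apply: lerD; apply: ler_piMr => //; [exact: norm_cos_le1|exact: norm_sin_le1].
have := FH mH bH dH dH'.
under eq_Rintegral do rewrite inner0.
rewrite Rintegral_cst// mul0r.
under eq_Rintegral do rewrite inner1.
have dfg := decays_gauss_shift y a0 d1.
rewrite RintegralZ_decays// => /esym /eqP; rewrite mulf_eq0 invr_eq0 gt_eqF ?sqrtr_gt0//=.
by move=> /eqP.
Qed.

(** Half of the exponent absorbs the factor |u|: with v = sqrt(a) |u|, v <= 1 + v^2 <= e^{v^2} <=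
    e^{(pi/2) v^2}. *)
Lemma abs_gauss_le a u : 0 < a ->
  `|u| * gauss a u <= (Num.sqrt a)^-1 * gauss (a / 2) u.
Proof.
move=> a0; have sa0 : 0 < Num.sqrt a by rewrite sqrtr_gt0.
have -> : gauss a u = gauss (a / 2) u * gauss (a / 2) u.
  by rewrite /gauss -expRD; congr expR; field.
rewrite [leLHS]mulrA ler_wpM2r ?(ltW (gauss_gt0 _ _))// -[leRHS]mulr1 ler_pdivlMl//.
rewrite [leLHS]mulrA /gauss mulNr expRN ler_pdivrMr ?expR_gt0// mul1r.
set v := Num.sqrt a * `|u|.
have v2 : v ^+ 2 = a * u ^+ 2.
  by rewrite exprMn sqr_sqrtr ?(ltW a0)// real_normK ?num_real.
have -> : pi * (a / 2) * u ^+ 2 = pi / 2 * v ^+ 2 by rewrite v2; ring.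
apply: (@le_trans _ _ (1 + v ^+ 2)).
  by have := sqr_ge0 (v - 1); rewrite sqrrB1 => h; have := sqr_ge0 v; nra.
apply: (le_trans (expR_ge1Dx _)); rewrite ler_expR ler_peMl ?sqr_ge0//.
by have := @pi_ge2 R; lra.
Qed.

(** A quantitative approximate identity. Since the average of [f] vanishes, f(y) / sqrt(a) is the
    integral of (f(y) - f(x)) [gauss a (x - y)], which the Lipschitz bound makes at most L /
    (sqrt(a) sqrt(a/2)). So |f(y)| sqrt(a/2) <= L for every a > 0, which forces f(y) = 0. *)
Lemma gauss_average_inj f (L : R) : decays f ->
  (forall x y, `|f x - f y| <= L * `|x - y|) ->
  (forall a y, 0 < a -> \int[mu]_x (f x * gauss a (x - y)) = 0) ->
  forall y, f y = 0.
Proof.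
move=> df fL f0 y.
have L0 : 0 <= L.
  by have := le_trans (normr_ge0 _) (fL 1 0); rewrite subr0 normr1 mulr1.
have main a : 0 < a -> `|f y| * Num.sqrt (a / 2) <= L.
  move=> a0; have sa0 : 0 < Num.sqrt a by rewrite sqrtr_gt0.
  have a20 : 0 < a / 2 by rewrite divr_gt0.
  have ig := integrable_gauss_shift y a0.
  have ig2 := integrable_gauss_shift y a20.
  have c1 : mu.-integrable setT (EFin \o (fun x => f y * gauss a (x - y))).
    have -> : (EFin \o (fun x => f y * gauss a (x - y))) =
      (fun x => ((f y)%:E * (EFin \o (fun x => gauss a (x - y))) x)%E).
      by apply/funext => x; rewrite /= EFinM.
    exact: integrableZl.
  have c2 : mu.-integrable setT (EFin \o (fun x => f x * gauss a (x - y))).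
    exact: integrable_decays (decays_gauss_shift y a0 df).
  have c3 : mu.-integrable setT
      (EFin \o (fun x => L * (Num.sqrt a)^-1 * gauss (a / 2) (x - y))).
    have -> : (EFin \o (fun x => L * (Num.sqrt a)^-1 * gauss (a / 2) (x - y))) =
      (fun x => ((L * (Num.sqrt a)^-1)%:E * (EFin \o (fun x => gauss (a / 2) (x - y))) x)%E).
      by apply/funext => x; rewrite /= EFinM.
    exact: integrableZl.
  have c12 : mu.-integrable setT
      (EFin \o (fun x => f y * gauss a (x - y) - f x * gauss a (x - y))).
    exact: (integrableB _ c1 c2).
  have E : f y * (Num.sqrt a)^-1 =
      \int[mu]_x (f y * gauss a (x - y) - f x * gauss a (x - y)).
    rewrite RintegralB// f0// subr0 RintegralZl//; congr (_ * _).
    by rewrite /Rintegral integral_gauss_shift.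
  have : `|f y * (Num.sqrt a)^-1| <= L * (Num.sqrt a)^-1 * (Num.sqrt (a / 2))^-1.
    rewrite E (le_trans (le_normr_Rintegral _ _))//.
    apply: (@le_trans _ _ (\int[mu]_x (L * (Num.sqrt a)^-1 * gauss (a / 2) (x - y)))).
      apply: le_Rintegral => //; first exact: integrable_norm c12.
      move=> x _; rewrite -mulrBl normrM norm_gauss -mulrA.
      apply: (@le_trans _ _ (L * (`|x - y| * gauss a (x - y)))).
        by rewrite mulrA ler_wpM2r ?(ltW (gauss_gt0 _ _))// distrC.
      by rewrite ler_wpM2l// abs_gauss_le.
    rewrite RintegralZl//; last first.
    by rewrite /Rintegral integral_gauss_shift.
  rewrite normrM (@ger0_norm _ (Num.sqrt a)^-1) ?invr_ge0 ?sqrtr_ge0// [leRHS]mulrAC.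
  rewrite ler_pM2r ?invr_gt0// => h.
  by rewrite -ler_pdivlMr// sqrtr_gt0.
apply/eqP; rewrite -normr_eq0; apply/negPn/negP => fy0.
have fy : 0 < `|f y| by rewrite lt0r fy0 normr_ge0.
have T0 : 0 < (L + 1) / `|f y| by rewrite divr_gt0// ltr_wpDl.
(* This [a] has sqrt(a/2) = (L + 1) / |f(y)|, so the bound reads L + 1 <= L. *)
have := main (2 * ((L + 1) / `|f y|) ^+ 2).
rewrite mulr_gt0 ?exprn_gt0// => /(_ isT).
rewrite mulrAC divff ?mul1r ?pnatr_eq0// sqrtr_sqr (ger0_norm (ltW T0)).
by rewrite mulrCA divff// mulr1; lra.
Qed.

Lemma schwartz_lipschitz f : schwartzR f ->
  exists L, forall x y, `|f x - f y| <= L * `|x - y|.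
Proof.
move=> sf; have [C hC] := sf.2 0%N 1%N; exists C.
have wlg x y : x < y -> `|f x - f y| <= C * `|x - y|.
  move=> xy.
  have df (t : R) : is_derive t 1 f (derive1n 1 f t) := schwartz_is_derive 0 t sf.
  have cf : continuous f := is_derive_continuous df.
  have [|c _ E] := @MVT _ f (derive1n 1 f) x y xy (fun t _ => df t).
    exact: continuous_subspaceT.
  rewrite distrC E normrM (distrC x) ler_wpM2r//.
  by have := hC c; rewrite expr0 mul1r.
move=> x y; have [xy|yx|->] := ltgtP x y; first exact: wlg.
- by rewrite distrC (distrC x); exact: wlg.
- by rewrite !subrr normr0 mulr0.
Qed.

Lemma fourier_eq0 (f : cfun R) : schwartz f ->
  (forall xi, (fourier f).1 xi = 0) -> (forall xi, (fourier f).2 xi = 0) ->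
  f = cfun_zero R.
Proof.
case: f => f1 f2 [s1 s2] A0 B0; rewrite /= in s1 s2.
have d1 := schwartz_decays0 s1; have d2 := schwartz_decays0 s2.
have {}A0 xi : cosT f1 xi + sinT f2 xi = 0.
  by rewrite -(A0 xi); exact: esym (@fourier1E _ (f1, f2) xi d1 d2).
have {}B0 xi : cosT f2 xi - sinT f1 xi = 0.
  by rewrite -(B0 xi); exact: esym (@fourier2E _ (f1, f2) xi d1 d2).
have [L1 l1] := schwartz_lipschitz s1; have [L2 l2] := schwartz_lipschitz s2.
rewrite /cfun_zero; congr pair; apply/funext => y.
- apply: (gauss_average_inj d1 l1) => a z a0.
  exact: (gauss_average_eq0 _ a0 d1 d2).
(* For the imaginary part, the averaging lemma is applied to - i f = f2 - i f1, whose transform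
   vanishes too. *)
- apply: (gauss_average_inj d2 l2) => a z a0.
  apply: (gauss_average_eq0 _ a0 d2 (decaysZ (-1) d1)) => xi.
  + by rewrite sinTZ// mulN1r.
  + by rewrite cosTZ// mulN1r -opprD A0 oppr0.
Qed.

End uniqueness.

(** * Continuity along segments *)

Section complex_norms.
Context {R : realType}.
Implicit Types (f g : cfun R) (r : \bar R) (s t x : R).

Definition cdecays f := decays f.1 /\ decays f.2.

Lemma cmod_ge0 f x : 0 <= cmod f x.
Proof. exact: sqrtr_ge0. Qed.

Lemma cmod_eq0 f x : cmod f x = 0 -> f.1 x = 0 /\ f.2 x = 0.
Proof.
move=> /eqP; rewrite sqrtr_eq0 => h.
have h1 := sqr_ge0 (f.1 x); have h2 := sqr_ge0 (f.2 x).
by split; apply/eqP; rewrite -sqrf_eq0 eq_le; lra.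
Qed.

Lemma sqrt_minkowski (a b c d : R) :
  Num.sqrt ((a + c) ^+ 2 + (b + d) ^+ 2) <=
  Num.sqrt (a ^+ 2 + b ^+ 2) + Num.sqrt (c ^+ 2 + d ^+ 2).
Proof.
have n1 : 0 <= a ^+ 2 + b ^+ 2 by rewrite addr_ge0 ?sqr_ge0.
have n2 : 0 <= c ^+ 2 + d ^+ 2 by rewrite addr_ge0 ?sqr_ge0.
set X := Num.sqrt (a ^+ 2 + _); set Y := Num.sqrt (c ^+ 2 + _).
have X0 : 0 <= X := sqrtr_ge0 _; have Y0 : 0 <= Y := sqrtr_ge0 _.
have X2 : X ^+ 2 = a ^+ 2 + b ^+ 2 by rewrite sqr_sqrtr.
have Y2 : Y ^+ 2 = c ^+ 2 + d ^+ 2 by rewrite sqr_sqrtr.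
have XY0 : 0 <= X * Y := mulr_ge0 X0 Y0.
have acbd : a * c + b * d <= X * Y.
  apply: (le_trans (ler_norm _)).
  rewrite -(@ler_pXn2r _ 2) ?nnegrE// real_normK ?num_real// exprMn X2 Y2.
  (* Lagrange's identity: (a c + b d)^2 + (a d - b c)^2 = (a^2 + b^2) (c^2 + d^2). *)
  have := sqr_ge0 (a * d - b * c); nra.
rewrite -[leRHS]ger0_norm ?addr_ge0// -sqrtr_sqr ler_sqrt ?sqr_ge0//.
have -> : (X + Y) ^+ 2 = X ^+ 2 + Y ^+ 2 + 2 * (X * Y) by ring.
by rewrite X2 Y2; nra.
Qed.

Lemma cmod_le f x : cmod f x <= `|f.1 x| + `|f.2 x|.
Proof.
have := sqrt_minkowski (f.1 x) 0 0 (f.2 x).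
by rewrite addr0 add0r expr0n/= addr0 add0r !sqrtr_sqr.
Qed.

Lemma decays_cmod f : cdecays f -> decays (cmod f).
Proof.
move=> [d1 d2]; split.
  have c (h : R -> R) : continuous h -> continuous (fun x => h x ^+ 2).
    by move=> ch x; rewrite /(_ ^+ 2); apply: cvgM; exact: ch.
  move=> x; apply: (@continuous_comp _ _ _ (fun x => f.1 x ^+ 2 + f.2 x ^+ 2) Num.sqrt);
    last exact: sqrt_continuous.
  by apply: cvgD; [exact: (c _ d1.1)|exact: (c _ d2.1)].
have [_ [C hC]] := d1; have [_ [D hD]] := d2.
exists (C + D) => x; rewrite ger0_norm ?cmod_ge0// (le_trans (cmod_le _ _))//.
by rewrite mulrDl lerD.
Qed.

Lemma LrE r f : Lr r f = NL r (cmod f).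
Proof. by []. Qed.

Lemma schwartz_cdecays f : schwartz f -> cdecays f.
Proof. by move=> [s1 s2]; split; exact: schwartz_decays0. Qed.

Lemma fourierE f : cdecays f ->
  fourier f = (fun xi => cosT f.1 xi + sinT f.2 xi, fun xi => cosT f.2 xi - sinT f.1 xi).
Proof.
move=> [d1 d2]; rewrite (surjective_pairing (fourier f)).
congr pair; apply/funext => xi; [exact: fourier1E|exact: fourier2E].
Qed.

Lemma fourier_cdecays f : schwartz f -> cdecays (fourier f).
Proof.
move=> sf; have [s1 s2] := sf; rewrite fourierE; last exact: schwartz_cdecays.
split; apply: decaysD.
- exact: schwartz_decays_cosT.
- exact: schwartz_decays_sinT.
- exact: schwartz_decays_cosT.
- by apply: decaysN; exact: schwartz_decays_sinT.
Qed.

Lemma Lr_gt0 r f x : (1 <= r)%E -> cdecays f -> f.1 x <> 0 \/ f.2 x <> 0 ->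
  0 < Lr r f.
Proof.
move=> r1 df fx; rewrite LrE; apply: (@NL_gt0 _ _ _ x) => //; first exact: decays_cmod.
by apply/eqP => /cmod_eq0[]; case: fx.
Qed.

Lemma Lr_gt0_schwartz r f : (1 <= r)%E -> schwartz f -> f <> cfun_zero R ->
  0 < Lr r f.
Proof.
move=> r1 sf f0.
have [[x fx]|nx] := pselect (exists x, f.1 x <> 0 \/ f.2 x <> 0).
  by apply: (Lr_gt0 (x := x)) => //; exact: schwartz_cdecays.
exfalso; apply: f0; rewrite (surjective_pairing f) /cfun_zero; congr pair;
  apply/funext => x; apply: contrapT => fx; apply: nx; exists x; by [left|right].
Qed.

Lemma Lr_gt0_fourier r f : (1 <= r)%E -> schwartz f -> f <> cfun_zero R ->
  0 < Lr r (fourier f).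
Proof.
move=> r1 sf f0.
have [[x fx]|nx] :=
    pselect (exists x, (fourier f).1 x <> 0 \/ (fourier f).2 x <> 0).
  by apply: (Lr_gt0 (x := x)) => //; exact: fourier_cdecays.
exfalso; apply: f0; apply: fourier_eq0 => // x;
  apply: contrapT => fx; apply: nx; exists x; by [left|right].
Qed.

Lemma Fpq_gt0 (p q : \bar R) f : (1 <= p)%E -> (1 <= q)%E -> schwartz f ->
  f <> cfun_zero R -> 0 < Fpq p q f.
Proof.
move=> p1 q1 sf f0; apply: divr_gt0; apply: mulr_gt0;
  by [exact: Lr_gt0_schwartz|exact: Lr_gt0_fourier].
Qed.

Definition segment f g s : cfun R :=
  (fun x => (1 - s) * f.1 x + s * g.1 x, fun x => (1 - s) * f.2 x + s * g.2 x).

Lemma segment0 f g : segment f g 0 = f.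
Proof.
rewrite (surjective_pairing f); congr pair; apply/funext => x /=;
  by rewrite subr0 mul1r mul0r addr0.
Qed.

Lemma segment1 f g : segment f g 1 = g.
Proof.
rewrite (surjective_pairing g); congr pair; apply/funext => x /=;
  by rewrite subrr mul0r mul1r add0r.
Qed.

Lemma schwartz_segment f g s : schwartz f -> schwartz g -> schwartz (segment f g s).
Proof. by move=> [f1 f2] [g1 g2]; split; exact: schwartzR_lin. Qed.

Lemma cdecays_segment f g s : cdecays f -> cdecays g -> cdecays (segment f g s).
Proof. by move=> [f1 f2] [g1 g2]; split; apply: decaysD; exact: decaysZ. Qed.

Lemma fourier_segment f g s : cdecays f -> cdecays g ->
  fourier (segment f g s) = segment (fourier f) (fourier g) s.
Proof.
move=> df dg; rewrite !fourierE//; last exact: cdecays_segment.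
have [f1 f2] := df; have [g1 g2] := dg.
congr pair; apply/funext => xi /=.
- rewrite cosTD; [|exact: decaysZ..]; rewrite sinTD; [|exact: decaysZ..].
  by rewrite !cosTZ// !sinTZ//; ring.
- rewrite cosTD; [|exact: decaysZ..]; rewrite sinTD; [|exact: decaysZ..].
  by rewrite !cosTZ// !sinTZ//; ring.
Qed.

(** The point at parameter t is the point at s plus (t - s) (g - f). Taking norms makes every L^r
    norm Lipschitz in the parameter. *)
Lemma cmod_segment_le f g s t x :
  cmod (segment f g t) x <=
  cmod (segment f g s) x + `|t - s| * (cmod f x + cmod g x).
Proof.
have -> : cmod (segment f g t) x =
  Num.sqrt (((segment f g s).1 x + (t - s) * (g.1 x - f.1 x)) ^+ 2
          + ((segment f g s).2 x + (t - s) * (g.2 x - f.2 x)) ^+ 2).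
  by rewrite /cmod /=; congr (Num.sqrt (_ ^+ 2 + _ ^+ 2)); ring.
apply: (le_trans (sqrt_minkowski _ _ _ _)); rewrite lerD2l.
rewrite !exprMn -mulrDr sqrtrM ?sqr_ge0// sqrtr_sqr ler_wpM2l// [leRHS]addrC.
by apply: (le_trans (sqrt_minkowski _ _ _ _)); rewrite !sqrrN.
Qed.

Lemma Lr_segment_le r f g s t : (1 <= r)%E -> cdecays f -> cdecays g ->
  Lr r (segment f g t) <= Lr r (segment f g s) + `|t - s| * (Lr r f + Lr r g).
Proof.
move=> r1 df dg; rewrite !LrE.
have dc u := decays_cmod (cdecays_segment u df dg).
have dcf := decays_cmod df; have dcg := decays_cmod dg.
apply: (@le_trans _ _ (NL r (fun x => cmod (segment f g s) x
    + `|t - s| * (cmod f x + cmod g x)))).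
  apply: le_NL => //.
    by apply: decaysD => //; apply: decaysZ; exact: decaysD.
  move=> x; rewrite ger0_norm ?cmod_ge0// (le_trans _ (ler_norm _))//.
  exact: cmod_segment_le.
apply: (le_trans (NLD _ _ _)) => //; first by apply: decaysZ; exact: decaysD.
rewrite lerD2l NLZ//; last exact: decaysD.
by rewrite ler_wpM2l// NLD.
Qed.

Lemma continuous_Lr_segment r f g : (1 <= r)%E -> cdecays f -> cdecays g ->
  continuous (fun s => Lr r (segment f g s)).
Proof.
move=> r1 df dg s0; apply/cvgrPdist_le => e e0.
set M := Lr r f + Lr r g.
have M0 : 0 <= M by rewrite addr_ge0 ?NL_ge0.
(* [M] can be 0, so the radius is e / (M + 1). *)
have M1 : 0 < M + 1 by rewrite ltr_wpDl.
near=> s.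
have ds : `|s0 - s| <= e / (M + 1).
  by near: s; apply: (@cvgr_dist_le _ _ _ _ _ id) => //; exact: divr_gt0.
have b u v : `|u - v| <= e / (M + 1) -> Lr r (segment f g u) - Lr r (segment f g v) <= e.
  move=> uv; rewrite lerBlDl (le_trans (Lr_segment_le v u r1 df dg))// lerD2l.
  apply: (@le_trans _ _ (e / (M + 1) * M)); first by rewrite ler_wpM2r.
  by rewrite mulrAC ler_pdivrMr// ler_wpM2l ?(ltW e0)// lerDl.
by rewrite ler_norml lerNl opprB !b// distrC.
Unshelve. all: by end_near. Qed.

Lemma Fpq_segment (p q : \bar R) f g t : (1 <= p)%E -> (1 <= q)%E ->
  schwartz f -> schwartz g -> (forall s, segment f g s <> cfun_zero R) ->
  Fpq p q f <= t -> t <= Fpq p q g ->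
  exists h, (schwartz h /\ h <> cfun_zero R) /\ Fpq p q h = t.
Proof.
move=> p1 q1 sf sg nz ft tg.
have df := schwartz_cdecays sf; have dg := schwartz_cdecays sg.
have dff := fourier_cdecays sf; have dfg := fourier_cdecays sg.
pose N r s := Lr r (segment f g s) * Lr r (fourier (segment f g s)).
have NE r : N r = fun s => Lr r (segment f g s) * Lr r (segment (fourier f) (fourier g) s).
  by apply/funext => s; rewrite /N fourier_segment.
have cN r : (1 <= r)%E -> continuous (N r).
  by move=> r1 s; rewrite NE; apply: cvgM; exact: continuous_Lr_segment.
have N0 r s : (1 <= r)%E -> 0 < N r s.
  move=> r1; have ss := schwartz_segment s sf sg.
  by apply: mulr_gt0; [exact: Lr_gt0_schwartz|exact: Lr_gt0_fourier].
(* A zero of [G] is a point where F = t, because [N p] is positive along the segment; in this form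
   the intermediate value theorem needs no continuity of a quotient. *)
pose G s := N q s - t * N p s.
have cG : continuous G.
  by move=> s; apply: cvgB; [exact: cN|apply: cvgM; [exact: cvg_cst|exact: cN]].
have G0 : G 0 <= 0.
  rewrite subr_le0 -ler_pdivrMr; last exact: N0.
  by move: ft; rewrite /N segment0.
have G1 : 0 <= G 1.
  rewrite subr_ge0 -ler_pdivlMr; last exact: N0.
  by move: tg; rewrite /N segment1.
have [|s _ /eqP] := @IVT _ G 0 1 0 ler01 (continuous_subspaceT cG).
  by rewrite ge_min G0/= le_max G1 orbT.
rewrite subr_eq0 => /eqP Gs; exists (segment f g s); split.
  by split; [exact: schwartz_segment|exact: nz].
by rewrite /Fpq -/(N q s) -/(N p s) Gs mulfK// gt_eqF// N0.
Qed.

End complex_norms.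

(** * Small and large values *)

Section extremes.
Context {R : realType}.
Implicit Types (r q : \bar R) (p s t : R).

Lemma expR_unbounded (d M : R) : 0 < d -> exists2 s, 0 < s & M <= expR (d * s).
Proof.
move=> d0; exists ((`|M| + 1) / d); first by rewrite divr_gt0// ltr_wpDl.
rewrite mulrC divfK ?gt_eqF//; apply: (le_trans _ (expR_ge1Dx _)).
by have := ler_norm M; lra.
Qed.

Lemma inv_exponent_lt p q : 1 < p -> (p%:E < q)%E -> inv_exponent q < p^-1.
Proof.
move=> p1; have p0 : 0 < p := lt_trans ltr01 p1.
case: q => [q| |]//=; last by rewrite invr_gt0.
by rewrite lte_fin => pq; rewrite ltf_pV2// posrE// (lt_trans p0).
Qed.

(** The point where the imaginary part is non-zero later keeps the segment away from 0. *)
Lemma Fpq_small p q t : 1 < p -> (p%:E < q)%E -> 0 < t ->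
  exists f : cfun R, [/\ schwartz f, exists x, f.2 x != 0 & Fpq p%:E q f <= t].
Proof.
move=> p1 pq t0; have pe1 : (1 <= p%:E)%E by rewrite lee_fin ltW.
have q1 : (1 <= q)%E by rewrite (le_trans pe1)// ltW.
have [kp kp0 hp] := NL_gauss_scale pe1; have [kq kq0 hq] := NL_gauss_scale q1.
have th : 0 < 2 * (p^-1 - inv_exponent q) by rewrite mulr_gt0// subr_gt0 inv_exponent_lt.
(* F will equal (kq/kp)^2 e^{-2 s (1/p - 1/q)}; this [s] makes it at most t. *)
have [s s0 hs] := expR_unbounded (kq ^+ 2 / (t * kp ^+ 2)) th.
have e1 : 1 < expR (4 * s) by rewrite expR_gt1 mulr_gt0.
(* Chosen so that 1 + b^2 = e^{4s}: the modulus of the transform is then a multiple of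
   [gauss (expR (4 * - s))]. *)
pose b := Num.sqrt (expR (4 * s) - 1).
have b0 : 0 < b by rewrite sqrtr_gt0 subr_gt0.
have b2 : 1 ^+ 2 + b ^+ 2 = expR (4 * s).
  by rewrite sqr_sqrtr ?subr_ge0 ?(ltW e1)// expr1n addrC subrK.
have sf := schwartz_chirp b (@ltr01 R).
(* At this point pi b x^2 = pi/2, where the sine is 1. *)
have f2 : (chirp 1 b).2 (Num.sqrt ((2 * b)^-1)) != 0.
  rewrite /= sqr_sqrtr ?invr_ge0 ?mulr_ge0 ?(ltW b0)//.
  have -> : pi * b * (2 * b)^-1 = pi / 2.
    by move: (pi : R) => P; field; rewrite gt_eqF.
  by rewrite sin_pihalf mulr1 oppr_eq0 gt_eqF// gauss_gt0.
have fn0 : chirp 1 b <> cfun_zero R by move=> E; rewrite E eqxx in f2.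
exists (chirp 1 b); split => //; first by exists (Num.sqrt ((2 * b)^-1)).
have [c c0 hc] := cmod_fourier_chirp b (@ltr01 R).
have aE : 1 / (1 ^+ 2 + b ^+ 2) = expR (4 * - s).
  by rewrite b2 mulrN expRN div1r.
have one : 1 = expR (4 * 0) :> R by rewrite mulr0 expR0.
have N1 r k : NL r (gauss (expR (4 * 0))) = k * expR (- (2 * 0 * inv_exponent r)) ->
    Lr r (chirp 1 b) = k.
  by move=> h; rewrite LrE cmod_chirp one h mulr0 mul0r oppr0 expR0 mulr1.
have N2 r k : (1 <= r)%E ->
    NL r (gauss (expR (4 * - s))) = k * expR (- (2 * - s * inv_exponent r)) ->
    Lr r (fourier (chirp 1 b)) = c * (k * expR (2 * s * inv_exponent r)).
  move=> r1 h; rewrite LrE.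
  have -> : cmod (fourier (chirp 1 b)) = (fun xi => c * gauss (expR (4 * - s)) xi).
    by apply/funext => xi; rewrite hc aE.
  rewrite NLZ//; last exact: decays_gauss (expR_gt0 _).
  by rewrite h; congr (_ * (_ * expR _)); ring.
(* The positive norm of the transform shows that [c] is not 0, so it can be cancelled. *)
have := Lr_gt0_fourier pe1 sf fn0.
rewrite /Fpq (N1 _ _ (hp 0)) (N1 _ _ (hq 0)) (N2 _ _ pe1 (hp (- s))) (N2 _ _ q1 (hq (- s))).
set u := expR (2 * s * inv_exponent p%:E); set v := expR (2 * s * inv_exponent q).
have u0 : 0 < u := expR_gt0 _; have v0 : 0 < v := expR_gt0 _.
rewrite pmulr_lgt0 ?mulr_gt0// => {}c0.
rewrite ler_pdivrMr ?mulr_gt0//.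
have uE : u = expR (2 * (p^-1 - inv_exponent q) * s) * v.
  by rewrite /u /v -expRD /=; congr expR; ring.
rewrite ler_pdivrMr ?mulr_gt0 ?exprn_gt0// in hs.
set D := expR (2 * (p^-1 - inv_exponent q) * s) in hs uE.
have -> : kq * (c * (kq * v)) = c * v * kq ^+ 2 by ring.
have -> : t * (kp * (c * (kp * u))) = c * v * (D * (t * kp ^+ 2)) by rewrite uE; ring.
by rewrite ler_wpM2l// mulr_ge0 ?(ltW v0)// ltW.
Qed.

Lemma Fpq_large p q t : 1 < p -> (p%:E < q)%E -> p^-1 + inv_exponent q < 1 -> 0 < t ->
  exists f : cfun R, [/\ schwartz f, 0 < f.1 0, f.2 = (fun=> 0) & t <= Fpq p%:E q f].
Proof.
move=> p1 pq pq1 t0; have pe1 : (1 <= p%:E)%E by rewrite lee_fin ltW.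
have q1 : (1 <= q)%E by rewrite (le_trans pe1)// ltW.
have [kp kp0 hp] := NL_gauss_scale pe1; have [kq kq0 hq] := NL_gauss_scale q1.
have pq' := inv_exponent_lt p1 pq.
set th := inv_exponent q in pq1 pq'.
(* One entry for each term of [h]: by how much its exponent in the L^p norm, divided by s, falls
   short of 1 - 2/q. *)
pose d := Num.min (2 * (p^-1 - th)) (2 * (1 - p^-1 - th)).
have d0 : 0 < d by rewrite lt_min !mulr_gt0// ?subr_gt0//; lra.
(* Aims at ||h||_q >= (1 + t) ||h||_p, which suffices because (1 + t)^2 >= t; the 2 counts the terms
   of [h]. *)
have [s s0 hs] := expR_unbounded (2 * kp * (1 + t) / kq) d0.
pose g1 := gauss (expR (4 * s)); pose g2 := gauss (expR (4 * - s)).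
have dg1 : decays g1 := decays_gauss (expR_gt0 _).
have dg2 : decays g2 := decays_gauss (expR_gt0 _).
pose h x := expR s * g1 x + expR (- s) * g2 x.
have sh : schwartzR h.
  by apply: schwartzR_lin; apply: schwartz_gauss; exact: expR_gt0.
have dh : decays h := schwartz_decays0 sh.
have h0 x : 0 < h x by rewrite addr_gt0// mulr_gt0 ?expR_gt0 ?gauss_gt0.
have s00 : schwartzR (fun=> 0 : R).
  have := schwartzR_lin 0 0 sh sh; congr schwartzR; apply/funext => x.
  by rewrite !mul0r addr0.
pose f : cfun R := (h, fun=> 0).
have sf : schwartz f by split.
(* The transform exchanges the two terms: it sends e^s [g1] to e^{-s} [g2] and back. *)
have fE : fourier f = f.
  rewrite fourierE; last exact: schwartz_cdecays.
  congr pair; apply/funext => xi /=.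
  - rewrite cosTD; [|exact: decaysZ..]; rewrite !cosTZ// !cosT_gauss ?expR_gt0//.
    rewrite !sqrtr_expR4 -!expRN -!mulrN opprK !mulrA -!expRD.
    by rewrite sinT0 addr0 addrC /h /g1 /g2 /gauss -!expRD; congr (expR _ + expR _); ring.
  - rewrite sinTD; [|exact: decaysZ..]; rewrite !sinTZ// !sinT_gauss ?expR_gt0//.
    by rewrite !mulr0 addr0 subr0 cosT0.
exists f; split => //=.
have cE : cmod f = h.
  apply/funext => x; rewrite /cmod /= expr0n/= addr0 sqrtr_sqr ger0_norm//.
  exact: ltW.
rewrite /Fpq fE !LrE cE.
have e r : (1 <= r)%E -> 0 < NL r h.
  by move=> r1; apply: (@NL_gt0 _ _ _ 0) => //; rewrite gt_eqF.
(* Up to the factor [kq], the L^q norm of the concentrated term e^s [g1], which [h] dominates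
   pointwise. *)
set E1 := expR (s * (1 - 2 * th)).
have E10 : 0 < E1 := expR_gt0 _.
have lq : kq * E1 <= NL q h.
  apply: (@le_trans _ _ (NL q (fun x => expR s * g1 x))).
    rewrite NLZ ?(ltW (expR_gt0 _))// hq -/th.
    have -> : kq * E1 = expR s * (kq * expR (- (2 * s * th))); last by [].
    by rewrite mulrCA -expRD; congr (_ * expR _); ring.
  apply: le_NL => //; first exact: decaysZ.
  move=> x; rewrite !ger0_norm ?(ltW (h0 _)) ?mulr_ge0 ?(ltW (expR_gt0 _))//.
  by rewrite lerDl mulr_ge0 ?(ltW (expR_gt0 _)).
have up : NL p%:E h <= kp * (2 * (E1 * expR (- (d * s)))).
  apply: (le_trans (NLD _ _ _)) => //; [exact: decaysZ..|].
  rewrite !NLZ ?(ltW (expR_gt0 _))// !hp.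
  have -> : expR s * (kp * expR (- (2 * s * inv_exponent p%:E))) =
     kp * expR (s - 2 * s * p^-1) by rewrite mulrCA -expRD.
  have -> : expR (- s) * (kp * expR (- (2 * - s * inv_exponent p%:E))) =
     kp * expR (- s + 2 * s * p^-1).
    by rewrite mulrCA -expRD; congr (_ * expR _); rewrite /=; ring.
  rewrite -mulrDr ler_pM2l// -expRD; set X := expR (s * (1 - 2 * th) + _).
  have -> : 2 * X = X + X by ring.
  have da : d <= 2 * (p^-1 - th) by rewrite ge_min lexx.
  have db : d <= 2 * (1 - p^-1 - th) by rewrite ge_min lexx orbT.
  apply: lerD; rewrite ler_expR.
  - by have := ler_wpM2r (ltW s0) da; lra.
  - by have := ler_wpM2r (ltW s0) db; lra.
have big : (1 + t) * NL p%:E h <= NL q h.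
  apply: le_trans lq; apply: (le_trans (ler_wpM2l _ up)); first lra.
  rewrite ler_pdivrMr// in hs.
  have -> : (1 + t) * (kp * (2 * (E1 * expR (- (d * s))))) =
     E1 * ((2 * kp * (1 + t)) * expR (- (d * s))) by ring.
  by rewrite [leRHS]mulrC ler_pM2l// expRN ler_pdivrMr ?expR_gt0// [leRHS]mulrC.
rewrite ler_pdivlMr ?mulr_gt0 ?e//.
have Np := e _ pe1.
have sq : ((1 + t) * NL p%:E h) * ((1 + t) * NL p%:E h) <= NL q h * NL q h.
  by apply: ler_pM => //; rewrite mulr_ge0 ?NL_ge0//; lra.
apply: le_trans sq; nra.
Qed.

End extremes.

Unset Implicit Arguments.

Theorem theorem4p6 (R : realType) (p : R) (q : \bar R)
  (hp : 1 < p) (hpq : (p%:E < q)%E)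
  (hpq1 : forall r : R, q = r%:E -> p^-1 + r^-1 < 1) :
  [set Fpq p%:E q f | f in [set f : cfun R | schwartz f /\ f <> cfun_zero R]]
  = [set t : R | 0 < t].
Proof.
have p1 : (1 <= p%:E)%E by rewrite lee_fin ltW.
have q1 : (1 <= q)%E by rewrite (le_trans p1)// ltW.
have pq1 : p^-1 + inv_exponent q < 1.
  case: q hpq hpq1 {q1} => [q| |]//= _ h; first exact: h.
  by rewrite addr0 invf_lt1// (lt_trans ltr01).
apply/seteqP; split=> [_ [f [sf f0] <-]|t t0]; first exact: Fpq_gt0.
have [f [sf [x fx] ft]] := Fpq_small hp hpq t0.
have [g [sg g0 g2 gt]] := Fpq_large hp hpq pq1 t0.
(* At [x] only [f] has an imaginary part, so vanishing there forces s = 1; but then the value at 0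
   is that of [g], which is positive. *)
have nz s : segment f g s <> cfun_zero R.
  move=> E; have E1 := congr1 (fun h => h.1 0) E; have E2 := congr1 (fun h => h.2 x) E.
  move: E2; rewrite /= g2 mulr0 addr0 => /eqP; rewrite mulf_eq0 (negPf fx) orbF => /eqP s1.
  move: E1; rewrite /= s1 mul0r add0r.
  have -> : s = 1 by lra.
  by rewrite mul1r => g00; rewrite g00 ltxx in g0.
have [h [hh <-]] := Fpq_segment p1 q1 sf sg nz ft gt.
by exists h.
Qed.
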